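(* Let $n\ge1$ and let $\Lambda=KQ/(R)$ be a finite dimensional algebra with a minimal set $R$ of relations. Assume that $k\in Q_0$ is a sink admitting the $n$-APR tilting module $T_k$, and let $(Q',R'):=\sigma_k(Q,R)$. Then there is an algebra isomorphism $\mathrm{End}_\Lambda(T_k)\cong KQ'/(R')$, and $R'$ is a minimal set of relations.
   Context: Conventions: $K$ is an algebraically closed field; $Q$ is a finite connected acyclic quiver; algebras are basic, modules are finitely generated right modules, $D=\mathrm{Hom}_K(-,K)$. Paths are composed from left to right: a path from $i$ to $j$ lies in $e_iKQe_j$. $s(\cdot)$ and $e(\cdot)$ denote the start and end vertex of an arrow, path, or relation. Relations are linear combinations of paths of length at least two with common start and common end; minimal means that no proper subset generates the same ideal. $P_i=e_i\Lambda$, $I_i=D(\Lambda e_i)$. Composition $gf$ of morphisms means first $f$, then $g$. The sink $k$ admits the $n$-APR tilting module if $\mathrm{inj.dim}\,P_k=n$ and $\mathrm{Ext}^i_\Lambda(D\Lambda,P_k)=0$ for all $0\le i<n$; then $T_k:=\tau_n^-P_k\oplus\bigoplus_{j\ne k}P_j$, where $\tau_n^-=\mathrm{Ext}^n_\Lambda(D\Lambda,-)$. Construction of $\sigma_k(Q,R)$. Take a minimal injective resolution $0\to P_k\to I^0\to\cdots\to I^{n-1}\to I^n\to0$. Applying $\nu^{-1}=\mathrm{Hom}_\Lambda(D\Lambda,-)$ to its injective terms gives a minimal projective resolution $$0\to P^0\to\cdots\to P^{n-1}\xrightarrow{\alpha}P^n\xrightarrow{\beta}\tau_n^-P_k\to0,\qquad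 P^i=\nu^{-1}(I^i),$$ with $P^i\in\mathrm{add}(\bigoplus_{j\neq k}P_j)$ for $1\le i\le n$. Write $P^{n-1}=\bigoplus_{b\in B}P_{i_b}$ and $P^n=\bigoplus_{c\in C}P_{j_c}$ with finite index sets $B,C$, and $\alpha=(a_{cb})$ with $a_{cb}\in\mathrm{Hom}_\Lambda(P_{i_b},P_{j_c})=e_{j_c}\Lambda e_{i_b}$, represented by linear combinations (again denoted $a_{cb}$) of paths of $Q$ from $j_c$ to $i_b$. The new quiver with relations $(Q',R')=\sigma_k(Q,R)$ is: (1) $Q'_0=Q_0$; (2) $Q'_1=\{a\in Q_1\mid e(a)\ne k\}\sqcup\{a_c^*:k\to j_c\mid c\in C\}$, where the $a_c^*$ are new arrows; (3) $R'=0$ (no relations) if $n=1$, and $R'=\{r\in R\mid e(r)\ne k\}\sqcup\{\sum_{c\in C}a_c^*a_{cb}\mid b\in B\}$ if $n>1$.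
   Formalization: For n = 1 the construction's ''R' = 0'' is replaced by R' = {r in R | e(r) ≠ k} (no new relations), since with R nonempty the literal claim fails, e.g. 1→2→3→4 with R = {ab}, k = 4; for R empty the two agree. *)

(* Defs.v *)
From HB Require Import structures.
From mathcomp Require Import all_boot all_algebra.
From mathcomp Require Import boolp classical_sets.
From mathcomp Require Import finmap monalg.

Set Implicit Arguments.
Unset Strict Implicit.
Unset Printing Implicit Defensive.

Import GRing.Theory.
Local Open Scope ring_scope.
Local Open Scope classical_set_scope.
Local Open Scope quotient_scope.

(** * Modules: Hom groups, direct sums, subquotients *)

Section LinearMaps.
Variables (R : pzRingType) (U V : lmodType R).

Lemma linear_eq (f g : {linear U -> V}) : f =1 g -> f = g.
Proof.
case: f => f [[mf] [sf]]; case: g => g [[mg] [sg]] /= /funext fg.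
subst g; congr (GRing.Linear.Pack (GRing.Linear.Class _ _)).
  by rewrite (Prop_irrelevance mf mg).
by rewrite (Prop_irrelevance sf sg).
Qed.

Definition mklin (f : U -> V) (lf : linear f) : {linear U -> V} :=
  HB.pack_for {linear U -> V} f (GRing.isLinear.Build R U V *:%R f lf).

Definition Hom : Type := {linear U -> V}.

HB.instance Definition _ := gen_eqMixin Hom.
HB.instance Definition _ := gen_choiceMixin Hom.

Fact hom0_linear : linear (fun _ : U => 0 : V).
Proof. by move=> a x y; rewrite scaler0 addr0. Qed.

Fact homN_linear (f : Hom) : linear (fun x => - f x).
Proof. by move=> a x y; rewrite linearP opprD scalerN. Qed.

Fact homD_linear (f g : Hom) : linear (fun x => f x + g x).
Proof. by move=> a x y; rewrite !linearP scalerDr addrACA. Qed.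

Definition hom0 : Hom := mklin hom0_linear.
Definition homN (f : Hom) : Hom := mklin (homN_linear f).
Definition homD (f g : Hom) : Hom := mklin (homD_linear f g).

Fact homDA : associative homD.
Proof. by move=> f g h; apply: linear_eq => x /=; rewrite addrA. Qed.
Fact homDC : commutative homD.
Proof. by move=> f g; apply: linear_eq => x /=; rewrite addrC. Qed.
Fact hom0D : left_id hom0 homD.
Proof. by move=> f; apply: linear_eq => x /=; rewrite add0r. Qed.
Fact homND : left_inverse hom0 homN homD.
Proof. by move=> f; apply: linear_eq => x /=; rewrite addNr. Qed.

HB.instance Definition _ := GRing.isZmodule.Build Hom homDA homDC hom0D homND.

End LinearMaps.
Arguments Hom {R} U V.

Section DirectSum.
Variables (R : pzRingType) (I : finType) (M : I -> lmodType R).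

Definition dsum : Type := forall i, M i.

HB.instance Definition _ := Choice.on dsum.

Implicit Types x y z : dsum.
Definition dsum0 : dsum := fun i => 0.
Definition dsumN x : dsum := fun i => - x i.
Definition dsumD x y : dsum := fun i => x i + y i.
Definition dsumZ (a : R) x : dsum := fun i => a *: x i.

Fact dsumDA : associative dsumD.
Proof. by move=> x y z; apply: functional_extensionality_dep => i; exact: addrA. Qed.
Fact dsumDC : commutative dsumD.
Proof. by move=> x y; apply: functional_extensionality_dep => i; exact: addrC. Qed.
Fact dsum0D : left_id dsum0 dsumD.
Proof. by move=> x; apply: functional_extensionality_dep => i; exact: add0r. Qed.
Fact dsumND : left_inverse dsum0 dsumN dsumD.
Proof. by move=> x; apply: functional_extensionality_dep => i; exact: addNr. Qed.

HB.instance Definition _ := GRing.isZmodule.Build dsum dsumDA dsumDC dsum0D dsumND.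

Fact dsumZA a b x : dsumZ a (dsumZ b x) = dsumZ (a * b) x.
Proof. by apply: functional_extensionality_dep => i; exact: scalerA. Qed.
Fact dsumZ1 : left_id 1 dsumZ.
Proof. by move=> x; apply: functional_extensionality_dep => i; exact: scale1r. Qed.
Fact dsumZDr : right_distributive dsumZ +%R.
Proof. by move=> a x y; apply: functional_extensionality_dep => i; exact: scalerDr. Qed.
Fact dsumZDl x : {morph dsumZ^~ x : a b / a + b}.
Proof. by move=> a b; apply: functional_extensionality_dep => i; exact: scalerDl. Qed.

HB.instance Definition _ :=
  GRing.Zmodule_isLmodule.Build R dsum dsumZA dsumZ1 dsumZDr dsumZDl.

End DirectSum.

Section SubQuotient.
Variables (R : pzRingType) (V : lmodType R).

Definition submod (S : submodClosed V) : predArgType := {x : V | x \in S}.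
HB.instance Definition _ S := SubChoice.on (submod S).
HB.instance Definition _ S := [SubChoice_isSubLmodule of submod S by <:].

Variable S : submodClosed V.

Fact submodClosed_zmod : zmod_closed (S : {pred V}).
Proof. by split=> [|x y Sx Sy]; rewrite ?rpred0 // -scaleN1r rpredD ?rpredZ. Qed.
Definition zmod_of_submod : zmodClosed V :=
  HB.pack_for (zmodClosed V) (GRing.SubmodClosed.sort S)
    (GRing.isZmodClosed.Build V (GRing.SubmodClosed.sort S) submodClosed_zmod).

Definition quotmod : Type := Quotient.quot zmod_of_submod.
HB.instance Definition _ := GRing.Zmodule.on quotmod.
HB.instance Definition _ := EqQuotient.on quotmod.

End SubQuotient.

HB.lock Definition quotmodZ (R : pzRingType) (V : lmodType R) (S : submodClosed V)
  (a : R) (x : quotmod S) : quotmod S := \pi_(quotmod S) (a *: repr x).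

Section QuotientModule.
Variables (R : pzRingType) (V : lmodType R) (S : submodClosed V).
Local Notation quotmod := (quotmod S).
Local Notation quotmodZ := (@quotmodZ R V S).

Fact pi_quotmodD (x y : V) : \pi_quotmod (x + y) = \pi x + \pi y.
Proof. exact: (Quotient.pi_add (zmod_of_submod S) x y). Qed.

Fact pi_quotmodZ a (x : V) : \pi_quotmod (a *: x) = quotmodZ a (\pi x).
Proof.
rewrite quotmodZ.unlock; apply/eqP.
rewrite -[_ == _](Quotient.idealrBE (zmod_of_submod S)) -scalerBr.
by apply: (@rpredZ R V S); rewrite (Quotient.idealrBE (zmod_of_submod S)) reprK.
Qed.

Fact quotmod_surj (x : quotmod) : exists y, x = \pi_quotmod y.
Proof. by exists (repr x); rewrite reprK. Qed.

Fact quotmodZA a b x : quotmodZ a (quotmodZ b x) = quotmodZ (a * b) x.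
Proof. have [y ->] := quotmod_surj x.
by rewrite -(pi_quotmodZ b) -(pi_quotmodZ a) -(pi_quotmodZ (a * b)) scalerA. Qed.
Fact quotmodZ1 : left_id 1 quotmodZ.
Proof. by move=> x; have [y ->] := quotmod_surj x; rewrite -pi_quotmodZ scale1r. Qed.
Fact quotmodZDr : right_distributive quotmodZ +%R.
Proof.
move=> a x y; have [u ->] := quotmod_surj x; have [v ->] := quotmod_surj y.
by rewrite -pi_quotmodD -(pi_quotmodZ a u) -(pi_quotmodZ a v) -pi_quotmodZ scalerDr pi_quotmodD.
Qed.
Fact quotmodZDl x : {morph quotmodZ^~ x : a b / a + b}.
Proof.
move=> a b; have [y ->] := quotmod_surj x.
by rewrite -(pi_quotmodZ (a + b)) -(pi_quotmodZ a) -(pi_quotmodZ b) scalerDl pi_quotmodD.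
Qed.

HB.instance Definition _ := GRing.Zmodule_isLmodule.Build R quotmod
  quotmodZA quotmodZ1 quotmodZDr quotmodZDl.

End QuotientModule.

Section Homology.
Variables (R : pzRingType) (U V W : lmodType R).
Variables (f : {linear U -> V}) (g : {linear V -> W}).

Definition ker_pred : {pred V} := fun x => g x == 0.
Fact ker_closed : submod_closed ker_pred.
Proof.
split=> [|a x y]; rewrite !unfold_in ?linear0 //.
by move=> /eqP gx /eqP gy; rewrite linearP gx gy scaler0 addr0.
Qed.
HB.instance Definition _ := GRing.isSubmodClosed.Build R V ker_pred ker_closed.

Definition boundary_pred : {pred submod ker_pred} :=
  fun z => `[< exists u, f u = val z >].
Fact boundary_closed : submod_closed boundary_pred.
Proof.
split=> [|a x y]; rewrite !unfold_in.
  by apply/asboolP; exists 0; rewrite !linear0.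
move=> /asboolP[u fu] /asboolP[v fv]; apply/asboolP; exists (a *: u + v).
by rewrite !linearP fu fv.
Qed.
HB.instance Definition _ :=
  GRing.isSubmodClosed.Build R (submod ker_pred) boundary_pred boundary_closed.

(* ker g / im f; only used when g \o f = 0 *)
Definition homology : lmodType R := quotmod boundary_pred.

Definition hclass (z : submod ker_pred) : homology := \pi_(quotmod boundary_pred) z.

Lemma hclass_surj (x : homology) : exists z, x = hclass z.
Proof. exact: quotmod_surj. Qed.

Lemma hclass_linear : linear hclass.
Proof. by move=> a x y; rewrite /hclass pi_quotmodD pi_quotmodZ. Qed.

Lemma hclass_eq0 z : hclass z = 0 <-> exists u, f u = val z.
Proof.
have h := Quotient.idealrBE (zmod_of_submod boundary_pred) z 0.
have p0 : \pi_(quotmod boundary_pred) 0 = 0.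
  by have := pi_quotmodD boundary_pred 0 0; rewrite addr0 => /eqP; rewrite -subr_eq subrr => /eqP.
rewrite subr0 in h; rewrite -p0; split=> [/eqP e|e].
  by apply/asboolP; exact: (etrans h e).
by apply/eqP; exact: (etrans (esym h) (asboolT e)).
Qed.

End Homology.

(** * Complexes and injective resolutions *)

Section Resolutions.
Variable R : pzRingType.
Implicit Types M X Y : lmodType R.

Definition fingen M : Prop :=
  exists n (g : 'I_n -> M), forall x, exists a : 'I_n -> R,
    x = \sum_i a i *: g i.

Definition trivial_mod M : Prop := forall x : M, x = 0.

(* injective objects of the category of finitely generated modules *)
Definition injective_mod M : Prop :=
  forall (X Y : lmodType R) (i : {linear X -> Y}) (f : {linear X -> M}),
    fingen X -> fingen Y -> injective i ->
    exists g : {linear Y -> M}, forall x, g (i x) = f x.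

Definition essential_image X Y (f : {linear X -> Y}) : Prop :=
  forall N : {pred Y}, submod_closed N ->
    (exists2 y, y \in N & y != 0) -> exists2 x, f x \in N & f x != 0.

Record cochain := Cochain {
  cobj :> nat -> lmodType R;
  cdiff : forall i, {linear cobj i -> cobj i.+1};
  cdiffK : forall i (x : cobj i), cdiff i.+1 (cdiff i x) = 0 }.

Definition cohomology (C : cochain) (i : nat) : lmodType R :=
  if i is i'.+1 then homology (cdiff C i') (cdiff C i'.+1)
  else homology (hom0 (C 0) (C 0)) (cdiff C 0).

Record injres M := Injres {
  ircx :> cochain;
  iraug : {linear M -> ircx 0};
  irfg : forall i, fingen (ircx i);
  irinj : forall i, injective_mod (ircx i);
  iraug_inj : injective iraug;
  irexact0 : forall x, cdiff ircx 0 x = 0 -> exists y, x = iraug y;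
  iraugK : forall y, cdiff ircx 0 (iraug y) = 0;
  irexactS : forall i (x : ircx i.+1),
    cdiff ircx i.+1 x = 0 -> exists y, x = cdiff ircx i y }.

Definition minimal_injres M (C : injres M) : Prop :=
  essential_image (iraug C) /\ forall i, essential_image (cdiff C i).

Definition injres_length_le M (C : injres M) (n : nat) : Prop :=
  forall i, (n < i)%N -> trivial_mod (C i).

Definition inj_dim M (n : nat) : Prop :=
  (exists C : injres M, injres_length_le C n) /\
  forall m, (m < n)%N -> ~ exists C : injres M, injres_length_le C m.

End Resolutions.

(** * Quivers and path algebras *)

Record quiver := Quiver {
  vert : finType;
  arr : finType;
  src : arr -> vert;
  tgt : arr -> vert }.

Section Paths.
Variable Q : quiver.

Fixpoint composable (i : vert Q) (s : seq (arr Q)) : bool :=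
  if s is a :: s' then (src a == i) && composable (tgt a) s' else true.

(* a path is its start vertex and its sequence of arrows, in order of travel *)
Record qpath := QPath {
  qpath_val :> vert Q * seq (arr Q);
  _ : composable qpath_val.1 qpath_val.2 }.

HB.instance Definition _ := [isSub for qpath_val].
HB.instance Definition _ := [Choice of qpath by <:].

Definition pstart (p : qpath) : vert Q := p.1.
Definition parrows (p : qpath) : seq (arr Q) := p.2.
Definition pend (p : qpath) : vert Q := last (pstart p) (map (@tgt Q) (parrows p)).
Definition plength (p : qpath) : nat := size (parrows p).

Definition triv_path (i : vert Q) : qpath := @QPath (i, [::]) isT.

Fact arrow_composable (a : arr Q) : composable (src a) [:: a].
Proof. by rewrite /= eqxx. Qed.
Definition arrow_path (a : arr Q) : qpath :=
  @QPath (src a, [:: a]) (arrow_composable a).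

Definition pcat (p q : qpath) : option qpath :=
  if pend p == pstart q then insub (pstart p, parrows p ++ parrows q) else None.

Definition acyclic_quiver : Prop :=
  forall p : qpath, pstart p = pend p -> plength p = 0%N.

Definition adjacent : rel (vert Q) := fun i j =>
  [exists a : arr Q, ((src a == i) && (tgt a == j)) ||
                     ((src a == j) && (tgt a == i))].

Definition connected_quiver : Prop :=
  (0 < #|vert Q|)%N /\ forall i j, connect adjacent i j.

Definition is_sink (k : vert Q) : Prop := forall a : arr Q, src a != k.

Lemma composable_cat i s t :
  composable i (s ++ t) =
  composable i s && composable (last i (map (@tgt Q) s)) t.
Proof. by elim: s i => //= a s IH i; rewrite IH andbA. Qed.

Lemma qpath_eq p q : pstart p = pstart q -> parrows p = parrows q -> p = q.
Proof.
move=> e1 e2; apply: val_inj; move: e1 e2; rewrite /pstart /parrows /=.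
by case: (qpath_val p) (qpath_val q) => ? ? [? ?] /= -> ->.
Qed.

Lemma pcat_ex p q : pend p = pstart q ->
  exists r, [/\ pcat p q = Some r, pstart r = pstart p, pend r = pend q
              & parrows r = parrows p ++ parrows q].
Proof.
move=> e; have w : composable (pstart p) (parrows p ++ parrows q).
  by rewrite composable_cat (valP p) /= -/(pend p) e (valP q).
exists (@QPath (pstart p, parrows p ++ parrows q) w); split=> //.
  by rewrite /pcat e eqxx insubT.
by rewrite /pend /= map_cat last_cat -/(pend p) e.
Qed.

Lemma pcatN p q : pend p <> pstart q -> pcat p q = None.
Proof. by rewrite /pcat; case: eqP. Qed.

Lemma pcatA p q r :
  obind (pcat^~ r) (pcat p q) = obind (pcat p) (pcat q r).
Proof.
have [epq|npq] := pselect (pend p = pstart q); last first.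
  rewrite (pcatN npq) /=.
  have [eqr|nqr] := pselect (pend q = pstart r); last by rewrite pcatN.
  by have [s [-> es _ _]] /= := pcat_ex eqr; rewrite pcatN // es.
have [s [-> es1 es2 es3]] /= := pcat_ex epq.
have [eqr|nqr] := pselect (pend q = pstart r); last by rewrite !pcatN // es2.
have [t [-> et1 et2 et3]] /= := pcat_ex eqr.
have [u [-> eu1 _ eu3]] := pcat_ex (etrans es2 eqr).
have [v [-> ev1 _ ev3]] := pcat_ex (etrans epq (esym et1)).
congr Some; apply: qpath_eq; first by rewrite eu1 ev1.
by rewrite eu3 ev3 es3 et3 catA.
Qed.

Lemma pcat1p i p :
  pcat (triv_path i) p = if i == pstart p then Some p else None.
Proof.
case: eqP => [->|n]; last exact: (@pcatN (triv_path i) p n).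
have [r [-> er1 _ er3]] := @pcat_ex (triv_path (pstart p)) p erefl.
by congr Some; apply: qpath_eq.
Qed.

Lemma pcatp1 i p :
  pcat p (triv_path i) = if pend p == i then Some p else None.
Proof.
case: eqP => [e|n]; last exact: (@pcatN p (triv_path i) n).
have [r [-> er1 _ er3]] := @pcat_ex p (triv_path i) e.
by congr Some; apply: qpath_eq; rewrite // er3 cats0.
Qed.

End Paths.

(** * Path algebras *)

Section LinearExtension.
Variables (K : fieldType) (X : choiceType) (V : lmodType K) (h : X -> V).

(* the K-linear extension of a map defined on the basis X *)
Definition mext (f : {malg K[X]}) : V := \sum_(x <- msupp f) f@_x *: h x.

Lemma mextE (f : {malg K[X]}) (D : {fset X}) : (msupp f `<=` D)%fset ->
  mext f = \sum_(x <- D) f@_x *: h x.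
Proof.
move=> sD; rewrite /mext (big_fset_incl _ sD) // => x _ /mcoeff_outdom ->.
by rewrite scale0r.
Qed.

Fact mext_linear : linear mext.
Proof.
move=> a f g; set D := (msupp f `|` msupp g)%fset.
have sf : (msupp f `<=` D)%fset by exact: fsubsetUl.
have sg : (msupp g `<=` D)%fset by exact: fsubsetUr.
have sfg : (msupp (a *: f + g) `<=` D)%fset.
  apply: fsubset_trans (msuppD_le _ _) _; rewrite fsubUset sg andbT.
  exact: fsubset_trans (msuppZ_le _ _) sf.
rewrite (mextE sf) (mextE sg) (mextE sfg) scaler_sumr -big_split /=.
by apply: eq_bigr => x _; rewrite mcoeffD mcoeffZ scalerDl scalerA.
Qed.
HB.instance Definition _ :=
  GRing.isLinear.Build K {malg K[X]} V *:%R mext mext_linear.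

Lemma mextU x : mext << x >> = h x.
Proof. by rewrite (mextE msuppU_le) big_seq_fset1 mcoeffUU scale1r. Qed.

End LinearExtension.

Lemma malg_ext (K : fieldType) (X : choiceType) (V : lmodType K)
    (f g : {linear {malg K[X]} -> V}) :
  (forall x, f << x >> = g << x >>) -> f =1 g.
Proof.
have bE (u : {malg K[X]}) : u = \sum_(x <- msupp u) u@_x *: << x >>.
  rewrite {1}(monalgE u); apply: eq_bigr => x _; apply/malgP => y.
  by rewrite mcoeffZ !mcoeffU mulr_natr.
move=> fg u; rewrite (bE u) !linear_sum; apply: eq_bigr => x _.
by rewrite !linearZ /= fg.
Qed.

Definition pathalg (K : fieldType) (Q : quiver) : Type := {malg K[qpath Q]}.
HB.instance Definition _ K Q := GRing.Lmodule.on (pathalg K Q).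

HB.lock Definition pelt (K : fieldType) (Q : quiver) (p : qpath Q) : pathalg K Q :=
  << p >>.
Arguments pelt K {Q} p.

HB.lock Definition pmul (K : fieldType) (Q : quiver) (p q : qpath Q) : pathalg K Q :=
  oapp (pelt K) 0 (pcat p q).
Arguments pmul K {Q} p q.

HB.lock Definition pathalg_mul (K : fieldType) (Q : quiver) (f g : pathalg K Q) :
  pathalg K Q := mext (fun p => mext (pmul K p) g) f.

Section PathAlgebra.
Variables (K : fieldType) (Q : quiver).
Local Notation pathalg := (pathalg K Q).
Local Notation pelt := (pelt K).
Local Notation pathalg_mul := (@pathalg_mul K Q).
Implicit Types (p q : qpath Q) (f g : pathalg).

Definition pathalg_one : pathalg := \sum_(i : vert Q) pelt (triv_path i).

Fact pathalg_mul_linearl g : linear (pathalg_mul^~ g).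
Proof. by move=> a x y; rewrite !pathalg_mul.unlock linearP. Qed.

Fact pathalg_mul_linearr f : linear (pathalg_mul f).
Proof.
move=> a x y; rewrite !pathalg_mul.unlock /mext scaler_sumr -big_split /=.
apply: eq_bigr => p _; rewrite -!/(mext _ _) linearP scalerDr !scalerA.
by rewrite [_ * a]mulrC.
Qed.

Fact pathalg_mulU p q : pathalg_mul (pelt p) (pelt q) = pmul K p q.
Proof. by rewrite pathalg_mul.unlock pelt.unlock !mextU. Qed.

Lemma pathalg_ext (V : lmodType K) (f g : {linear pathalg -> V}) :
  (forall p, f (pelt p) = g (pelt p)) -> f =1 g.
Proof. by move=> fg; apply: malg_ext => p; move: (fg p); rewrite pelt.unlock. Qed.

Let mull g := mklin (pathalg_mul_linearl g).
Let mulr f := mklin (pathalg_mul_linearr f).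

Fact pathalg_mulA : associative pathalg_mul.
Proof.
move=> f g h.
apply: (@pathalg_ext _ (mull (pathalg_mul g h)) (mull h \o mull g)) => p /=.
apply: (@pathalg_ext _ (mulr (pelt p) \o mull h) (mull h \o mulr (pelt p))) => q /=.
apply: (@pathalg_ext _ (mulr (pelt p) \o mulr (pelt q))
  (mulr (pathalg_mul (pelt p) (pelt q)))) => r /=.
rewrite !pathalg_mulU pmul.unlock.
have e := pcatA p q r; have m0 f' : pathalg_mul f' 0 = 0 by exact: (linear0 (mulr f')).
have m0l f' : pathalg_mul 0 f' = 0 by exact: (linear0 (mull f')).
case: (pcat p q) e => [s|]; case: (pcat q r) => [t|] /= e.
- by rewrite (pathalg_mulU p t) (pathalg_mulU s r) pmul.unlock e.
- by rewrite (pathalg_mulU s r) pmul.unlock e m0.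
- by rewrite (pathalg_mulU p t) pmul.unlock -e m0l.
- by rewrite m0 m0l.
Qed.

Fact pathalg_mul1l : left_id pathalg_one pathalg_mul.
Proof.
move=> f; apply: (@pathalg_ext _ (mulr pathalg_one) idfun) => p /=.
have -> : pathalg_mul pathalg_one (pelt p) =
    \sum_i pathalg_mul (pelt (triv_path i)) (pelt p).
  exact: (linear_sum (mull (pelt p))).
rewrite (bigD1 (pstart p)) //=.
rewrite pathalg_mulU pmul.unlock pcat1p eqxx /= big1 ?addr0 // => i /negbTE n.
by rewrite pathalg_mulU pmul.unlock pcat1p n.
Qed.

Fact pathalg_mul1r : right_id pathalg_one pathalg_mul.
Proof.
move=> f; apply: (@pathalg_ext _ (mull pathalg_one) idfun) => p /=.
have -> : pathalg_mul (pelt p) pathalg_one =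
    \sum_i pathalg_mul (pelt p) (pelt (triv_path i)).
  exact: (linear_sum (mulr (pelt p))).
rewrite (bigD1 (pend p)) //=.
rewrite pathalg_mulU pmul.unlock pcatp1 eqxx /= big1 ?addr0 // => i /negbTE n.
by rewrite pathalg_mulU pmul.unlock pcatp1 eq_sym n.
Qed.

Fact pathalg_mulDl : left_distributive pathalg_mul +%R.
Proof. by move=> f g h; exact: (linearD (mull h)). Qed.

Fact pathalg_mulDr : right_distributive pathalg_mul +%R.
Proof. by move=> f g h; exact: (linearD (mulr f)). Qed.

HB.instance Definition _ := GRing.Zmodule_isPzRing.Build pathalg
  pathalg_mulA pathalg_mul1l pathalg_mul1r pathalg_mulDl pathalg_mulDr.

Lemma pelt_mul p q : (pelt p : pathalg) * pelt q = pmul K p q.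
Proof. exact: pathalg_mulU. Qed.

Lemma pathalg_scaleAl (a : K) (x y : pathalg) : a *: (x * y) = (a *: x) * y.
Proof. exact: esym (linearZ_LR (mull y) a x). Qed.

Lemma pathalg_scaleAr (a : K) (x y : pathalg) : a *: (x * y) = x * (a *: y).
Proof. exact: esym (linearZ_LR (mulr x) a y). Qed.

End PathAlgebra.

(** * Ideals, relations and bound quiver algebras *)

Section Quotient.
Variables (K : fieldType) (Q : quiver).
Local Notation KQ := (pathalg K Q).
Implicit Types R S : set KQ.

Definition two_sided_ideal (I : set KQ) : Prop :=
  [/\ I 0, forall x y, I x -> I y -> I (x + y) &
      forall x y, I y -> I (x * y) /\ I (y * x)].

Definition ideal (S : set KQ) : set KQ := smallest two_sided_ideal S.

Fact ideal_ideal S : two_sided_ideal (ideal S).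
Proof.
split=> [I [[]]//|x y Ix Iy I II|x y Iy].
  by have [[_ ID _] _] := II; apply: ID; [exact: Ix | exact: Iy].
by split=> I II; have [[_ _ IM] _] := II; case: (IM x y (Iy _ II)).
Qed.

Definition ideal_pred S : {pred KQ} := fun x => `[< ideal S x >].

Fact ideal_closed S : submod_closed (ideal_pred S).
Proof.
have [I0 ID IM] := ideal_ideal S.
split=> [|a x y]; rewrite !unfold_in; first exact/asboolP.
move=> /asboolP Ix /asboolP Iy; apply/asboolP; apply: ID => //.
have -> : a *: x = (a *: (1 : KQ) : KQ) * (x : KQ).
  by rewrite -pathalg_scaleAl mul1r.
by case: (IM (a *: (1 : KQ) : KQ) x Ix).
Qed.
HB.instance Definition _ S :=
  GRing.isSubmodClosed.Build K KQ (ideal_pred S) (ideal_closed S).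

(* paths of length at least two with a common start and a common end *)
Definition is_relation (r : KQ) : Prop :=
  exists i j, forall p, p \in msupp r ->
    [/\ pstart p = i, pend p = j & (2 <= plength p)%N].

Definition minimal_relations R : Prop :=
  (forall r, R r -> is_relation r) /\
  (forall S, S `<=` R -> ideal S = ideal R -> S = R).

Definition ends_at (k : vert Q) (r : KQ) : Prop :=
  forall p, p \in msupp r -> pend p = k.

Variable R : set KQ.

(* KQ/(R); the K-algebra structure consists of the instances pzRingType and
   [lmodType K], as algType would exclude the zero algebra                   *)
Definition quotalg : Type := quotmod (ideal_pred R).
HB.instance Definition _ := GRing.Lmodule.on quotalg.

Definition qpi (x : KQ) : quotalg := \pi_(quotmod (ideal_pred R)) x.

Fact qpi_linear : linear qpi.
Proof. by move=> a x y; rewrite /qpi pi_quotmodD pi_quotmodZ. Qed.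
HB.instance Definition _ :=
  GRing.isLinear.Build K KQ quotalg *:%R qpi qpi_linear.

Lemma qpi_surj (x : quotalg) : exists y, x = qpi y.
Proof. exact: quotmod_surj. Qed.

Lemma qpi_eq x y : (qpi x = qpi y) <-> ideal R (x - y).
Proof.
have h := Quotient.idealrBE (zmod_of_submod (ideal_pred R)) x y.
split=> [/eqP e|I]; first by apply/asboolP; exact: (etrans h e).
by apply/eqP; exact: (etrans (esym h) (asboolT I)).
Qed.

End Quotient.

HB.lock Definition qmul (K : fieldType) (Q : quiver) (R : set (pathalg K Q))
    (x y : quotalg R) : quotalg R :=
  qpi R (repr (x : quotmod _) * repr (y : quotmod _)).

Section QuotientAlgebra.
Variables (K : fieldType) (Q : quiver) (R : set (pathalg K Q)).
Local Notation KQ := (pathalg K Q).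
Local Notation quotalg := (quotalg R).
Local Notation qpi := (qpi R).
Local Notation qmul := (@qmul K Q R).

Fact qmulE x y : qmul (qpi x) (qpi y) = qpi (x * y).
Proof.
rewrite qmul.unlock.
have [I0 ID IM] := ideal_ideal R.
have rE z : ideal R (repr (qpi z : quotmod _) - z).
  by apply/qpi_eq; exact: (reprK (qpi z : quotmod _)).
apply/qpi_eq; set u := repr _; set v := repr _.
have -> : u * v - x * y = (u - x) * v + x * (v - y).
  by rewrite mulrBl mulrBr addrA subrK.
by apply: ID; [case: (IM v (u - x) (rE x)) | case: (IM x (v - y) (rE y))].
Qed.

Fact qmulA : associative qmul.
Proof.
move=> x y z; have [u ->] := qpi_surj x; have [v ->] := qpi_surj y.
by have [w ->] := qpi_surj z; rewrite !qmulE mulrA.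
Qed.
Fact qmul1l : left_id (qpi 1) qmul.
Proof. by move=> x; have [u ->] := qpi_surj x; rewrite qmulE mul1r. Qed.
Fact qmul1r : right_id (qpi 1) qmul.
Proof. by move=> x; have [u ->] := qpi_surj x; rewrite qmulE mulr1. Qed.
Fact qmulDl : left_distributive qmul +%R.
Proof.
move=> x y z; have [u ->] := qpi_surj x; have [v ->] := qpi_surj y.
by have [w ->] := qpi_surj z; rewrite -linearD !qmulE mulrDl linearD.
Qed.
Fact qmulDr : right_distributive qmul +%R.
Proof.
move=> x y z; have [u ->] := qpi_surj x; have [v ->] := qpi_surj y.
by have [w ->] := qpi_surj z; rewrite -linearD !qmulE mulrDr linearD.
Qed.

HB.instance Definition _ :=
  GRing.Zmodule_isPzRing.Build quotalg qmulA qmul1l qmul1r qmulDl qmulDr.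

Fact qpi_monoid_morphism : monoid_morphism qpi.
Proof. by split=> // x y; rewrite -qmulE. Qed.
HB.instance Definition _ :=
  GRing.isMonoidMorphism.Build KQ quotalg qpi qpi_monoid_morphism.

Lemma quotalg_scaleAl (a : K) (x y : quotalg) : a *: (x * y) = (a *: x) * y.
Proof.
have [u ->] := qpi_surj x; have [v ->] := qpi_surj y.
by rewrite -rmorphM -!linearZ_LR /= pathalg_scaleAl rmorphM.
Qed.
Lemma quotalg_scaleAr (a : K) (x y : quotalg) : a *: (x * y) = x * (a *: y).
Proof.
have [u ->] := qpi_surj x; have [v ->] := qpi_surj y.
by rewrite -rmorphM -!linearZ_LR /= pathalg_scaleAr rmorphM.
Qed.

End QuotientAlgebra.

(** * Modules over a bound quiver algebra

Right modules over L are left modules over the converse ring L^c, so that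
[a *: x] with [M : lmodType L^c] and [x : M] stands for the product x.a *)

Section BoundQuiverModules.
Variables (K : fieldType) (Q : quiver) (R : set (pathalg K Q)).
Local Notation L := (quotalg R).
Implicit Types (M N : lmodType L^c) (a b : L).

Definition idem (i : vert Q) : L := qpi R (pelt K (triv_path i)).

(* the right ideal e L, as a submodule of the right regular module *)
Definition rideal_pred (e : L) : {pred (L^c)^o} := fun x => `[< exists y : L, x = e * y >].

Fact rideal_closed (e : L) : submod_closed (rideal_pred e).
Proof.
split=> [|a x y]; rewrite !unfold_in.
  by apply/asboolP; exists 0; rewrite mulr0.
move=> /asboolP[u ->] /asboolP[v ->]; apply/asboolP; exists (u * a + v).
by rewrite mulrDr mulrA.
Qed.
HB.instance Definition _ e :=
  GRing.isSubmodClosed.Build L^c (L^c)^o (rideal_pred e) (rideal_closed e).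

(* P_i = e_i L *)
Definition Pmod (i : vert Q) : lmodType L^c := submod (rideal_pred (idem i)).

Definition Pval (i : vert Q) (x : Pmod i) : L := val x.

Lemma Pval_inj i : injective (@Pval i).
Proof. exact: val_inj. Qed.
Lemma PvalD i (x y : Pmod i) : Pval (x + y) = Pval x + Pval y.
Proof. exact: (linearD (val : submod (rideal_pred (idem i)) -> _)). Qed.
Lemma PvalZ i (a : L^c) (x : Pmod i) : Pval (a *: x) = Pval x * a.
Proof. exact: (linearZ_LR (val : submod (rideal_pred (idem i)) -> _)). Qed.
Lemma PvalE i (x : Pmod i) : exists y, Pval x = idem i * y.
Proof. by have /asboolP := valP x. Qed.
Lemma Pval_ex i (y : L) : exists x : Pmod i, Pval x = idem i * y.
Proof.
have y_in : (idem i * y) \in rideal_pred (idem i) by apply/asboolP; exists y.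
by exists (Sub (idem i * y) y_in); exact: SubK.
Qed.

(* D L = Hom_K(L, K), with (g.a)(x) = g(a x) *)
Definition dual : Type := Hom (L : lmodType K) K^o.
HB.instance Definition _ := GRing.Zmodule.on dual.

Fact dual_rmul_linear a (g : dual) : linear (fun x : L => g (a * x) : K^o).
Proof. by move=> c x y; rewrite mulrDr -quotalg_scaleAr linearP. Qed.
Definition dual_rmul (a : L^c) (g : dual) : dual := mklin (dual_rmul_linear a g).

Fact dual_rmulA (a b : L^c) g : dual_rmul a (dual_rmul b g) = dual_rmul (a * b) g.
Proof. by apply: linear_eq => x /=; rewrite mulrA. Qed.
Fact dual_rmul1 : left_id 1 dual_rmul.
Proof. by move=> g; apply: linear_eq => x /=; rewrite mul1r. Qed.
Fact dual_rmulDr : right_distributive dual_rmul +%R.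
Proof. by move=> a f g; apply: linear_eq. Qed.
Fact dual_rmulDl g : {morph dual_rmul^~ g : a b / a + b}.
Proof. by move=> a b; apply: linear_eq => x /=; rewrite mulrDl linearD. Qed.
HB.instance Definition _ := GRing.Zmodule_isLmodule.Build L^c dual
  dual_rmulA dual_rmul1 dual_rmulDr dual_rmulDl.

(* the left action on D L: (a.g)(x) = g(x a) *)
Fact dual_lmul_subproof a (g : dual) : linear (fun x : L => g (x * a) : K^o).
Proof. by move=> c x y; rewrite mulrDl -quotalg_scaleAl linearP. Qed.
Definition dual_lmul a (g : dual) : dual := mklin (dual_lmul_subproof a g).
Fact dual_lmul_linear a : linear (dual_lmul a).
Proof. by move=> b f g; apply: linear_eq => x /=; rewrite mulrA. Qed.
HB.instance Definition _ a :=
  GRing.isLinear.Build L^c dual dual *:%R (dual_lmul a) (dual_lmul_linear a).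

(* nu^- M = Hom_L(D L, M), with (h.a)(g) = h(a.g) *)
Definition nuinv M : Type := Hom (dual : lmodType L^c) M.
HB.instance Definition _ M := GRing.Zmodule.on (nuinv M).

Section NuInv.
Variable M : lmodType L^c.
Implicit Types h : nuinv M.

Fact nuinv_rmul_linear a h : linear (fun g : dual => h (dual_lmul a g)).
Proof. by move=> b f g; rewrite !linearP. Qed.
Definition nuinv_rmul (a : L^c) h : nuinv M := mklin (nuinv_rmul_linear a h).

Fact nuinv_rmulA (a b : L^c) h :
  nuinv_rmul a (nuinv_rmul b h) = nuinv_rmul (a * b) h.
Proof.
apply: linear_eq => g /=; congr (h _).
by apply: linear_eq => x /=; rewrite mulrA.
Qed.
Fact nuinv_rmul1 : left_id 1 nuinv_rmul.
Proof.
move=> h; apply: linear_eq => g /=; congr (h _).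
by apply: linear_eq => x /=; rewrite mulr1.
Qed.
Fact nuinv_rmulDr : right_distributive nuinv_rmul +%R.
Proof. by move=> a f g; apply: linear_eq. Qed.
Fact nuinv_rmulDl h : {morph nuinv_rmul^~ h : a b / a + b}.
Proof.
move=> a b; apply: linear_eq => g /=; rewrite -linearD; congr (h _).
by apply: linear_eq => x /=; rewrite mulrDr linearD.
Qed.
HB.instance Definition _ := GRing.Zmodule_isLmodule.Build L^c (nuinv M)
  nuinv_rmulA nuinv_rmul1 nuinv_rmulDr nuinv_rmulDl.

End NuInv.

Fact nuinv_map_subproof M N (d : {linear M -> N}) (h : nuinv M) :
  linear (fun g : dual => d (h g)).
Proof. by move=> a f g; rewrite !linearP. Qed.
Definition nuinv_map_fun M N (d : {linear M -> N}) (h : nuinv M) : nuinv N :=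
  mklin (nuinv_map_subproof d h).
Fact nuinv_map_linear M N (d : {linear M -> N}) : linear (nuinv_map_fun d).
Proof. by move=> a f g; apply: linear_eq => x /=; rewrite linearD. Qed.
Definition nuinv_map M N (d : {linear M -> N}) : {linear nuinv M -> nuinv N} :=
  mklin (nuinv_map_linear d).

Fact nuinv_cdiffK (C : cochain L^c) i (h : nuinv (C i)) :
  nuinv_map (cdiff C i.+1) (nuinv_map (cdiff C i) h) = 0.
Proof. by apply: linear_eq => g /=; exact: cdiffK. Qed.
Definition nuinv_cochain (C : cochain L^c) : cochain L^c :=
  Cochain (@nuinv_cdiffK C).

(* Ext^i_L(D L, M), computed from an injective resolution C of M *)
Definition ExtD M (C : injres M) (i : nat) : lmodType L^c :=
  cohomology (nuinv_cochain C) i.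

(* the K-algebra End_L(M): the product g * f is "first f, then g" *)
Definition End M : Type := Hom M M.
HB.instance Definition _ M := GRing.Zmodule.on (End M).

Section EndAlgebra.
Variable M : lmodType L^c.
Implicit Types f g h : End M.

Definition end1 : End M := idfun.
Definition end_mul g f : End M := g \o f.

Fact end_mulA : associative end_mul.
Proof. by move=> f g h; apply: linear_eq. Qed.
Fact end_mul1l : left_id end1 end_mul.
Proof. by move=> f; apply: linear_eq. Qed.
Fact end_mul1r : right_id end1 end_mul.
Proof. by move=> f; apply: linear_eq. Qed.
Fact end_mulDl : left_distributive end_mul +%R.
Proof. by move=> f g h; apply: linear_eq. Qed.
Fact end_mulDr : right_distributive end_mul +%R.
Proof. by move=> f g h; apply: linear_eq => x /=; rewrite linearD. Qed.
HB.instance Definition _ := GRing.Zmodule_isPzRing.Build (End M)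
  end_mulA end_mul1l end_mul1r end_mulDl end_mulDr.

(* the scalar c : K acts on M through the central element c.1 of L *)
Definition scal (c : K) : L^c := c *: (1 : L).

Fact scal_central c (a : L^c) : scal c * a = a * scal c.
Proof.
rewrite /scal; have e : (a : L) * (c *: (1 : L)) = (c *: (1 : L)) * (a : L).
  by rewrite -quotalg_scaleAr -quotalg_scaleAl mulr1 mul1r.
exact: e.
Qed.

Fact end_scale_linear c f : linear (fun x => scal c *: f x).
Proof.
by move=> a x y; rewrite linearP scalerDr !scalerA scal_central.
Qed.
Definition end_scale c f : End M := mklin (end_scale_linear c f).

Fact scalM c d : scal c * scal d = scal (c * d).
Proof.
transitivity ((scal d : L) * (scal c : L)); first by [].
by rewrite /scal -quotalg_scaleAl mul1r scalerA mulrC.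
Qed.

Fact end_scaleA c d f : end_scale c (end_scale d f) = end_scale (c * d) f.
Proof.
by apply: linear_eq => x; rewrite -[RHS]/(scal (c * d) *: f x) -scalM -scalerA.
Qed.
Fact end_scale1 : left_id 1 end_scale.
Proof. by move=> f; apply: linear_eq => x /=; rewrite /scal !scale1r. Qed.
Fact end_scaleDr : right_distributive end_scale +%R.
Proof. by move=> c f g; apply: linear_eq => x /=; rewrite scalerDr. Qed.
Fact end_scaleDl f : {morph end_scale^~ f : c d / c + d}.
Proof.
by move=> c d; apply: linear_eq => x /=; rewrite /scal !scalerDl.
Qed.
HB.instance Definition _ := GRing.Zmodule_isLmodule.Build K (End M)
  end_scaleA end_scale1 end_scaleDr end_scaleDl.

Lemma end_scaleAl (c : K) f g : c *: (f * g) = (c *: f) * g.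
Proof. exact: linear_eq. Qed.
Lemma end_scaleAr (c : K) f g : c *: (f * g) = f * (c *: g).
Proof. by apply: linear_eq => x /=; rewrite linearZ. Qed.

End EndAlgebra.

(** * n-APR tilting modules *)

Definition admits_nAPR (n : nat) (k : vert Q) : Prop :=
  inj_dim (Pmod k) n /\
  forall (C : injres (Pmod k)) i, (i < n)%N -> trivial_mod (ExtD C i).

Section APR.
Variables (n : nat) (k : vert Q) (C : injres (Pmod k)).

(* the summand tau_n^- P_k = Ext^n_L(D L, P_k) sits at the index k *)
Definition nAPR_summand (j : vert Q) : lmodType L^c :=
  if j == k then ExtD C n else Pmod j.

Definition nAPR_module : lmodType L^c := dsum nAPR_summand.

End APR.

End BoundQuiverModules.

(** * The mutated quiver with relations *)

Section Mutation.
Variables (Q : quiver) (k : vert Q) (B C : finType) (j : C -> vert Q).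

Definition mut_arr : finType := ({a : arr Q | tgt a != k} + C)%type.

Definition mut_quiver : quiver := Quiver
  (fun a : mut_arr => if a is inl b then src (val b) else k)
  (fun a : mut_arr => match a with inl b => tgt (val b) | inr c => j c end).

Definition mut_arrow (a : arr Q) : option (arr mut_quiver) := omap inl (insub a).

(* a path of Q all of whose arrows survive, seen as a path of the new quiver *)
Definition mut_path (p : qpath Q) : option (qpath mut_quiver) :=
  if all (fun a => tgt a != k) (parrows p) then
    insub ((pstart p, pmap mut_arrow (parrows p))
           : vert mut_quiver * seq (arr mut_quiver))
  else None.

Variable K : fieldType.

(* deletes the paths that use an arrow into k *)
Definition mut_embed (x : pathalg K Q) : pathalg K mut_quiver :=
  mext (fun p => oapp (pelt K) 0 (mut_path p)) x.

Definition star (c : C) : pathalg K mut_quiver :=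
  pelt K (@arrow_path mut_quiver (inr c)).

(* For n = 1 only the old relations not ending at k remain (none, if L is
   hereditary): P^(n-1) is then P_k itself, and the paths in the a_cb end at k *)
Definition mut_relations (n : nat) (R : set (pathalg K Q))
    (a : C -> B -> pathalg K Q) : set (pathalg K mut_quiver) :=
  mut_embed @` [set r | R r /\ ~ ends_at k r] `|`
  [set r | (1 < n)%N /\ exists b, r = \sum_c star c * mut_embed (a c b)].

End Mutation.
Arguments mut_relations {Q} k {B C} j {K} n R a.

(* Main.v *)
Require Import Defs.
From HB Require Import structures.
From mathcomp Require Import all_boot all_algebra.
From mathcomp Require Import boolp classical_sets.
From mathcomp Require Import finmap monalg.

Set Implicit Arguments.
Unset Strict Implicit.
Unset Printing Implicit Defensive.

Import GRing.Theory.
Local Open Scope ring_scope.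

(* Let L = KQ/(R), n = m + 1 and nu^- = Hom(D L, -). Since L is finite-dimensional,
   every finitely generated injective is a summand of a power of D L, and
   End(D L) = L, so that nu^- is fully faithful on injectives. Let I be the minimal
   injective resolution of P_k and tau = tau_n^- P_k = coker(nu^- I^m -> nu^- I^n).
   A map tau -> L lifts to a map I^n -> D L that vanishes on the image of the
   surjection I^m -> I^n, so Hom(tau, L) = 0; an endomorphism of tau lifts down the
   complex, which is exact in degrees 1..m, to a self-map of I inducing a scalar on
   P_k, hence is that scalar up to homotopy, and End(tau) = K. So End(T_k) is the
   triangular algebra with corners K and (1 - e_k) L (1 - e_k) and bimodule tau.
   On the other side k is a source of Q', so that
   KQ' = K e_k + sum_c a_c^* KQ + (1 - e_k) KQ (1 - e_k), and the relations cut the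
   middle term down to coker(sum_b P_(i_b) -> sum_c P_(j_c)) = tau.
   Minimality of the resolution enters through socle elements of type S_v: they are
   killed by every differential, which gives j_c <> k, i_b <> k for n > 1 (and
   i_b = k for n = 1), the absence of trivial paths in the a_cb, and the fact that
   no kernel element of the matrix (a_cb) has an invertible coordinate. *)

(** * Finitely generated and injective modules *)

Lemma fingen_finType (R : pzRingType) (M : lmodType R) (T : finType) (g : T -> M) :
  (forall x, exists a : T -> R, x = \sum_t a t *: g t) -> fingen M.
Proof.
move=> gen; exists #|T|, (fun i => g (enum_val i)) => x.
have [a ->] := gen x; exists (fun i => a (enum_val i)).
by rewrite (reindex _ (onW_bij _ (@enum_val_bij T))).
Qed.

Lemma fingen_dsum (R : pzRingType) (T : finType) (M : T -> lmodType R) :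
  (forall t, fingen (M t)) -> fingen (dsum M).
Proof.
move=> fM; have [n nP] := choice fM; have {nP} [g gP] : exists g : forall t, 'I_(n t) -> M t,
    forall t x, exists a : 'I_(n t) -> R, x = \sum_i a i *: g t i.
  exists (fun t => sval (cid (nP t))) => t; exact: (svalP (cid (nP t))).
(* A generator of one summand, extended by zero; the dependent type of the coordinates forces the
   cast along a classically decided equality. *)
pose h (u : {t : T & 'I_(n t)}) : dsum M := fun t =>
  match pselect (tag u = t) with
  | left e => ecast t (M t) e (g (tag u) (tagged u))
  | right _ => 0 end.
apply: (@fingen_finType _ _ {t : T & 'I_(n t)} h) => x.
have [a aP] : exists a : forall t, 'I_(n t) -> R, forall t, x t = \sum_i a t i *: g t i.
  exists (fun t => sval (cid (gP t (x t)))) => t; exact: (svalP (cid (gP t (x t)))).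
exists (fun u => a (tag u) (tagged u)).
apply: functional_extensionality_dep => t.
have ev : forall (U : finType) (F : U -> dsum M), (\sum_u F u) t = \sum_u F u t.
  move=> U F; by elim/big_rec2: _ => // i y1 y2 _ <-.
rewrite ev (aP t).
pose F s (i : 'I_(n s)) : M t := (a s i *: h (existT _ s i)) t.
have -> : \sum_u (a (tag u) (tagged u) *: h u) t = \sum_s \sum_i F s i.
  rewrite sig_big_dep /=; by apply: eq_bigr => -[].
rewrite (bigD1 t) //= [X in _ + X]big1 ?addr0.
  apply: eq_bigr => i _; rewrite /F.
  change (a t i *: g t i = a t i *: h (existT _ t i) t); congr (_ *: _).
  rewrite /h /=; case: pselect => // e; by rewrite (Prop_irrelevance e erefl).
move=> s /eqP st; apply: big1 => i _.
change (a s i *: h (existT _ s i) t = 0).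
by rewrite /h /=; case: pselect => // _; rewrite scaler0.
Qed.

Lemma fingen_surj (R : pzRingType) (M N : lmodType R) (f : {linear M -> N}) :
  (forall y, exists x, y = f x) -> fingen M -> fingen N.
Proof.
move=> fs [n [g gen]]; exists n, (f \o g) => y; have [x ->] := fs y.
have [a ->] := gen x; exists a; rewrite linear_sum; apply: eq_bigr => i _.
by rewrite linearZ.
Qed.

(** Induction on the number of generators: a nontrivial linear dependence allows one of them to be
    dropped, and without one the coefficients are unique, hence linear in the vector. *)
Lemma fingen_dual_basis (K : fieldType) (V : lmodType K) : fingen V ->
  exists n (v : 'I_n -> V) (phi : 'I_n -> {linear V -> K^o}),
    forall x, x = \sum_t phi t x *: v t.
Proof.
move=> [n [g gen]]; elim: n g gen => [|n IH] g gen.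
  exists 0%N, g, (fun _ => hom0 _ _) => x; have [a ->] := gen x.
  by rewrite !big_ord0.
have [[a a0 [s as0]]|free] := pselect (exists2 a : 'I_n.+1 -> K,
    \sum_i a i *: g i = 0 & exists s, a s != 0).
  apply: (IH (fun i => g (lift s i))) => x; have [c ->] := gen x.
  exists (fun i => c (lift s i) - c s / a s * a (lift s i)).
  have gs : g s = - \sum_i (a (lift s i) / a s) *: g (lift s i).
    move: a0; rewrite (bigD1_ord s) //= => /eqP; rewrite addr_eq0 => /eqP e.
    rewrite -[LHS](scale1r) -(mulVf as0) -scalerA e scalerN scaler_sumr.
    by congr (- _); apply: eq_bigr => i _; rewrite scalerA mulrC.
  rewrite (bigD1_ord s) //= gs scalerN scaler_sumr addrC -sumrN -big_split /=.
  apply: eq_bigr => i _; rewrite scalerA scalerBl mulrA; congr (_ - _ *: _).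
  by rewrite mulrAC.
have uniq (a b : 'I_n.+1 -> K) : \sum_i a i *: g i = \sum_i b i *: g i -> a =1 b.
  move=> e i; apply/eqP; rewrite -subr_eq0; apply/negPn/negP => ne; apply: free.
  exists (fun i => a i - b i); last by exists i.
  by under eq_bigr do rewrite scalerBl; rewrite sumrB e subrr.
pose co x := sval (cid (gen x)).
have coP x : x = \sum_i co x i *: g i by exact: (svalP (cid (gen x))).
have colin t : linear (fun x => co x t : K^o).
  move=> c x y; apply: (uniq (co (c *: x + y)) (fun t => c * co x t + co y t)).
  rewrite -coP {1}(coP x) {1}(coP y) scaler_sumr -big_split /=.
  by apply: eq_bigr => i _; rewrite scalerDl scalerA.
by exists n.+1, g, (fun t => mklin (colin t)) => x; exact: coP.
Qed.

Lemma fingen_functional (K : fieldType) (V : lmodType K) (x : V) : fingen V ->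
  (forall phi : {linear V -> K^o}, phi x = 0) -> x = 0.
Proof.
move=> /fingen_dual_basis[n [v [phi vphi]]] x0; rewrite (vphi x).
by apply: big1 => t _; rewrite x0 scale0r.
Qed.

(** Since [G] kills the kernel of [d], it factors through the image of [d]; injectivity is applied
    to the inclusion of that image in [Y]. The image is finitely generated as a quotient of [X]. *)
Lemma injective_mod_extend (R : pzRingType) (J X Y : lmodType R)
    (d : {linear X -> Y}) (G : {linear X -> J}) :
  injective_mod J -> fingen X -> fingen Y -> (forall x, d x = 0 -> G x = 0) ->
  exists s : {linear Y -> J}, forall x, s (d x) = G x.
Proof.
move=> injJ fX fY dG.
pose im : {pred Y} := fun y => `[< exists x, y = d x >].
have im_closed : submod_closed im.
  split=> [|c y z]; rewrite !unfold_in.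
    by apply/asboolP; exists 0; rewrite linear0.
  move=> /asboolP[u ->] /asboolP[v ->]; apply/asboolP; exists (c *: u + v).
  by rewrite linearP.
pose S : submodClosed Y := HB.pack_for (submodClosed Y) im
  (GRing.isSubmodClosed.Build R Y im im_closed).
pose Z : lmodType R := submod S.
have vlin : linear (val : Z -> Y) by move=> c x y; rewrite linearP.
pose inc : {linear Z -> Y} := mklin vlin.
have d_in x : d x \in S by apply/asboolP; exists x.
pose d' x : Z := Sub (d x) (d_in x).
have d'lin : linear d' by move=> c x y; apply: val_inj; rewrite linearP !SubK linearP.
have fZ : fingen Z.
  apply: (@fingen_surj R X Z (mklin d'lin)) fX => z.
  by have /asboolP[x xz] := valP z; exists x; apply: val_inj; rewrite SubK.
have zP (z : Z) : exists x, val z = d x by have /asboolP[x xz] := valP z; exists x.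
pose r z := sval (cid (zP z)).
have rP z : val z = d (r z) by exact: (svalP (cid (zP z))).
have Geq x x' : d x = d x' -> G x = G x'.
  by move=> e; apply/eqP; rewrite -subr_eq0 -linearB dG // linearB e subrr.
have Grlin : linear (fun z => G (r z)).
  by move=> c y z; rewrite -linearP; apply: Geq; rewrite -rP !linearP -!rP.
have [s sP] := injJ Z Y inc (mklin Grlin) fZ fY val_inj.
exists s => x; have incd : inc (d' x) = d x by exact: SubK.
by rewrite -incd sP /=; apply: Geq; rewrite -rP.
Qed.

(** * Duality over a finite-dimensional bound quiver algebra *)

Section RestrictScalars.
Variables (K : fieldType) (Q : quiver) (R : set (pathalg K Q)).
Local Notation L := (quotalg R).
Variable M : lmodType L^c.

(** An alias of the carrier, so that the action of [K] through [scal] can be declared next to the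
    given action of [L]. *)
Definition resK : Type := M.
HB.instance Definition _ := GRing.Zmodule.on resK.
Definition resK_scale (c : K) (x : resK) : resK := scal R c *: (x : M).

Fact resK_scaleA c d x : resK_scale c (resK_scale d x) = resK_scale (c * d) x.
Proof. by rewrite /resK_scale scalerA scalM. Qed.
Fact resK_scale1 : left_id 1 resK_scale.
Proof. by move=> x; rewrite /resK_scale /scal !scale1r. Qed.
Fact resK_scaleDr : right_distributive resK_scale +%R.
Proof. by move=> c x y; exact: scalerDr. Qed.
Fact resK_scaleDl x : {morph resK_scale^~ x : c d / c + d}.
Proof. by move=> c d; rewrite /resK_scale /scal !scalerDl. Qed.
HB.instance Definition _ := GRing.Zmodule_isLmodule.Build K resK
  resK_scaleA resK_scale1 resK_scaleDr resK_scaleDl.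

(** The products of module generators with a spanning family of [L] span over [K]. *)
Lemma fingen_resK : fingen (L : lmodType K) -> fingen M -> fingen (resK : lmodType K).
Proof.
move=> [n [g gen]] [p [h hgen]].
apply: (@fingen_finType K resK ('I_p * 'I_n)%type
  (fun u => (g u.2 : L^c) *: h u.1 : M)) => x.
have [a ax] := hgen x.
have [b bP] : exists b : 'I_p -> 'I_n -> K, forall t, a t = \sum_i b t i *: g i.
  exists (fun t => sval (cid (gen (a t)))) => t; exact: (svalP (cid (gen (a t)))).
exists (fun u => b u.1 u.2); rewrite ax -(pair_bigA _ (fun t i =>
  (b t i *: ((g i : L^c) *: h t : resK) : resK))) /=.
apply: eq_bigr => t _; rewrite bP scaler_suml; apply: eq_bigr => i _.
transitivity ((scal R (b t i) * (g i : L^c)) *: h t); last by rewrite -scalerA.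
have e : b t i *: g i = g i * (b t i *: (1 : L)) by rewrite -quotalg_scaleAr mulr1.
exact: (congr1 (fun z : L^c => z *: h t) e).
Qed.

End RestrictScalars.

Section Duality.
Variables (K : fieldType) (Q : quiver) (R : set (pathalg K Q)).
Local Notation L := (quotalg R).
Hypothesis L_findim : fingen (L : lmodType K).
Local Notation D := (dual R : lmodType L^c).
Implicit Types (g h : dual R).

Lemma dual_scaleE (a : L) g (x : L) : ((a : L^c) *: g : dual R) x = g (a * x).
Proof. by []. Qed.

Lemma dual_sumE (T : finType) (F : T -> dual R) x : (\sum_t F t) x = \sum_t F t x.
Proof. by elim/big_rec2: _ => // t y1 y2 _ <-. Qed.

Lemma dual_ext g h : (forall x, g x = h x) -> g = h.
Proof. by move=> gh; exact: linear_eq. Qed.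

Lemma dual_scalE (c : K) g x : (scal R c *: g : dual R) x = c * g x.
Proof.
by rewrite dual_scaleE -quotalg_scaleAl mul1r linearZ.
Qed.

Lemma dual_separates (x : L) : (forall g, g x = 0) -> x = 0.
Proof. exact: fingen_functional. Qed.

(** The transpose of a dual basis of [L]: a functional is recovered from its values on the spanning
    family. *)
Lemma dual_coords : exists n (v : 'I_n -> L) (phi : 'I_n -> dual R),
  forall g, g = \sum_t scal R (g (v t)) *: phi t.
Proof.
have [n [v [phi vphi]]] := fingen_dual_basis L_findim.
exists n, v, phi => g; apply: dual_ext => x; rewrite dual_sumE {1}(vphi x) linear_sum.
by apply: eq_bigr => t _; rewrite dual_scalE linearZ mulrC.
Qed.

Lemma fingen_dual : fingen D.
Proof.
have [n [v [phi vphi]]] := dual_coords.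
by exists n, phi => g; exists (fun t => scal R (g (v t))); exact: vphi.
Qed.

(* double duality: g |-> u g 1 is the evaluation at some element of L *)
Lemma dual_End (u : {linear D -> D}) : exists a : L, forall g, u g = dual_lmul a g.
Proof.
have [n [v [phi vphi]]] := dual_coords.
exists (\sum_t (u (phi t) : dual R) 1 *: v t) => g; apply: dual_ext => x.
(* Linearity of [u] moves the evaluation point into the argument, so only the functional taking [g]
   to [u g 1] has to be understood. *)
have -> : (u g : dual R) x = (u ((x : L^c) *: g) : dual R) 1.
  by rewrite linearZ; change ((u g : dual R) x = (u g : dual R) (x * 1)); rewrite mulr1.
rewrite {1}(vphi ((x : L^c) *: g)) linear_sum dual_sumE /=.
rewrite mulr_sumr linear_sum; apply: eq_bigr => t _.
have -> : (u (scal R (((x : L^c) *: g : dual R) (v t)) *: phi t) : dual R) 1 =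
    g (x * v t) * (u (phi t) : dual R) 1.
  by rewrite linearZ; exact: dual_scalE.
by rewrite -quotalg_scaleAr linearZ mulrC.
Qed.

Section Functional.
Variables (M : lmodType L^c) (phi : {linear resK M -> K^o}).
Fact functional_fun_subproof (x : M) : linear (fun l : L => phi ((l : L^c) *: x) : K^o).
Proof.
move=> c l l'; rewrite scalerDl linearD; congr (_ + _).
rewrite -linearZ; congr (phi _).
transitivity ((scal R c * (l : L^c)) *: x); last by rewrite -scalerA.
have e : c *: l = l * (c *: (1 : L)) by rewrite -quotalg_scaleAr mulr1.
exact: (congr1 (fun z : L^c => z *: x) e).
Qed.
(** The adjunction between [Hom_K(M, K)] and [Hom_L(M, D L)]: a functional [phi] becomes the map
    sending [x] to [l |-> phi (x l)]. *)
Definition functional_fun (x : M) : dual R := mklin (functional_fun_subproof x).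
Fact functional_linear : linear (functional_fun : M -> D).
Proof.
move=> a x y; apply: dual_ext => l.
rewrite /= scalerDr linearD scalerA; congr (_ + _).
Qed.
Definition to_dual : {linear M -> D} := mklin functional_linear.
End Functional.

(** The coordinate functionals of [J] over [K] embed [J] into a power of [D L], and injectivity
    splits the embedding. The splitting is recorded in components, as a decomposition of the
    identity into maps through [D L]. *)
Lemma injective_mod_split (J : lmodType L^c) : fingen J -> injective_mod J ->
  exists n (i : 'I_n -> {linear J -> D}) (p : 'I_n -> nuinv J),
    forall x, x = \sum_t p t (i t x).
Proof.
move=> fJ injJ; have [n [v [phi vphi]]] := fingen_dual_basis (fingen_resK L_findim fJ).
pose DD := dsum (fun _ : 'I_n => D).
have iota_lin : linear (fun x => (fun t => to_dual (phi t) x) : DD).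
  by move=> a x y; apply: functional_extensionality_dep => t; rewrite linearP.
pose iota : {linear J -> DD} := mklin iota_lin.
(* Evaluation at 1 recovers the coordinate [phi t x]. *)
have iota_inj x : iota x = 0 -> x = 0.
  move=> ix; rewrite (vphi x); apply: big1 => t _.
  have := congr1 (fun g : dual R => g 1) (congr1 (fun h : DD => h t) ix).
  by rewrite /= scale1r => ->; rewrite scale0r.
have [p pP] := @injective_mod_extend _ J J DD iota idfun injJ fJ
  (fingen_dsum (fun=> fingen_dual)) iota_inj.
pose inn (t : 'I_n) (g : dual R) : DD := fun s => if s == t then g else 0.
have inn_lin t : linear (inn t : D -> DD).
  move=> a g h; apply: functional_extensionality_dep => s.
  change (inn t (a *: g + h) s = a *: inn t g s + inn t h s).
  by rewrite /inn; case: eqP => // _; rewrite scaler0 addr0.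
exists n, (fun t => to_dual (phi t)), (fun t => p \o mklin (inn_lin t)) => x.
have {pP} pP : p (iota x) = x := pP x.
rewrite -{1}pP -linear_sum; congr (p _).
have ev (F : 'I_n -> DD) s : (\sum_t F t) s = \sum_t F t s.
  by elim/big_rec2: _ => // i y1 y2 _ <-.
apply: functional_extensionality_dep => s; rewrite ev (bigD1 s) //= big1 /inn ?eqxx ?addr0 //.
by move=> t /negbTE ts; rewrite eq_sym ts.
Qed.

(** By the splitting, every element of [J] is a sum of values of maps from [D L], so these values
    determine any map out of [J]. *)
Lemma nuinv_faithful (J M : lmodType L^c) (G : {linear J -> M}) :
  fingen J -> injective_mod J -> (forall (u : nuinv J) g, G (u g) = 0) ->
  forall x, G x = 0.
Proof.
move=> fJ injJ G0 x; have [n [i [p ip]]] := injective_mod_split fJ injJ.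
by rewrite (ip x) linear_sum big1.
Qed.

Lemma nuinv_faithful2 (J M : lmodType L^c) (G H : {linear J -> M}) :
  fingen J -> injective_mod J -> (forall (u : nuinv J) g, G (u g) = H (u g)) ->
  forall x, G x = H x.
Proof.
move=> fJ injJ GH x; apply/eqP; rewrite -subr_eq0; apply/eqP.
apply: (@nuinv_faithful _ _ (homD (G : Defs.Hom J M) (homN H)) fJ injJ) => u g.
by change (G (u g) - H (u g) = 0); rewrite GH subrr.
Qed.

Lemma nuinv_ext (J : lmodType L^c) (u v : nuinv J) : (forall g, u g = v g) -> u = v.
Proof. by move=> e; exact: linear_eq. Qed.

Lemma nuinv_sumE (J : lmodType L^c) (T : finType) (F : T -> nuinv J) g :
  (\sum_t F t) g = \sum_t F t g.
Proof. by elim/big_rec2: _ => // t y1 y2 _ <-. Qed.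

(* with 1 = sum_t p_t i_t on J, the maps i_t o u are endomorphisms of D L, that
   is, elements of L, so that u = sum_t p_t o (i_t o u) is an L-combination of
   the p_t: the lift is determined by lifting the h p_t *)
Lemma nuinv_lift (J J' Y : lmodType L^c)
    (h : {linear nuinv J -> Y}) (beta : {linear nuinv J' -> Y}) :
  fingen J -> injective_mod J -> (forall u, exists w, beta w = h u) ->
  exists G : {linear J -> J'}, forall u, beta (nuinv_map G u) = h u.
Proof.
move=> fJ injJ hb; have [n [i [p ip]]] := injective_mod_split fJ injJ.
have [w wP] : exists w : 'I_n -> nuinv J', forall t, beta (w t) = h (p t).
  by have [w wP] := choice (fun t => hb (p t)); exists w.
have Glin : linear (fun x => \sum_t w t (i t x)).
  move=> a x y; rewrite scaler_sumr -big_split /=; apply: eq_bigr => t _.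
  by rewrite !linearP.
exists (mklin Glin) => u.
have [a aP] : exists a : 'I_n -> L, forall t g, i t (u g) = dual_lmul (a t) g.
  have [a aP] := choice (fun t => dual_End (i t \o u)); exists a => t g.
  exact: (aP t g).
have uE : u = \sum_t (a t : L^c) *: p t.
  apply: nuinv_ext => g; rewrite nuinv_sumE (ip (u g)); apply: eq_bigr => t _.
  by rewrite aP.
have GuE : nuinv_map (mklin Glin) u = \sum_t (a t : L^c) *: w t.
  apply: nuinv_ext => g; rewrite nuinv_sumE /=; apply: eq_bigr => t _.
  by rewrite aP.
rewrite GuE uE !linear_sum; apply: eq_bigr => t _.
by rewrite !linearZ wP.
Qed.

(* L is isomorphic to nu^-(D L) as a right module *)
Lemma nuinv_factor (J : lmodType L^c) (h : nuinv J -> L) :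
  (forall u v, h (u + v) = h u + h v) ->
  (forall (a : L) u, h ((a : L^c) *: u) = h u * a) ->
  fingen J -> injective_mod J ->
  exists G : {linear J -> D}, forall (u : nuinv J) g, G (u g) = dual_lmul (h u) g.
Proof.
move=> hD hZ fJ injJ.
have hlin : linear (fun u => dual_lmul (h u) : nuinv D).
  move=> a u v; apply: nuinv_ext => g; apply: dual_ext => x.
  by change (g (x * h (a *: u + v)) = g (x * h u * a) + g (x * h v));
    rewrite hD hZ -linearD mulrDr mulrA.
(* Lifting along the identity of [nu^- (D L)]: every linear map from [nu^- J] to [nu^- (D L)] is
   induced by a map from [J] to [D L]. *)
have [G GP] := @nuinv_lift J D (nuinv D) (mklin hlin) idfun fJ injJ (fun u =>
  ex_intro _ (mklin hlin u) erefl).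
by exists G => u g; have := congr1 (fun f : nuinv D => f g) (GP u).
Qed.

End Duality.

(** * The module Ext^n(D L, M) *)

Section NAPRTheory.
Variables (K : fieldType) (Q : quiver) (R : set (pathalg K Q)).
Local Notation L := (quotalg R).
Hypothesis L_findim : fingen (L : lmodType K).
Variables (M : lmodType L^c) (I : injres M).
Local Notation d i := (cdiff I i).
Local Notation delta i := (nuinv_map (cdiff I i)).

(** The form in which minimality is used: each term of the resolution has an essential image inside
    it, all of whose elements are cocycles, so every nonzero submodule contains a nonzero
    cocycle. *)
Lemma injres_essential (I_minimal : minimal_injres I) i (N : {pred I i}) :
  submod_closed N -> (exists2 y, y \in N & y != 0) ->
  exists z, [/\ z \in N, z != 0 & d i z = 0].
Proof.
have [ess0 essS] := I_minimal; case: i N => [|i] N Nsub Nnz.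
  have [x xN x0] := ess0 N Nsub Nnz.
  by exists (iraug I x); split=> //; exact: iraugK.
by have [x xN x0] := essS i N Nsub Nnz; exists (d i x); split=> //; exact: cdiffK.
Qed.

Lemma injres_last_surj m : injres_length_le I m.+1 ->
  forall x : I m.+1, exists y, x = d m y.
Proof. by move=> I_length x; apply: irexactS; exact: (I_length m.+2). Qed.

Lemma ExtD_exact i : trivial_mod (ExtD I i.+1) ->
  forall u, delta i.+1 u = 0 -> exists w, delta i w = u.
Proof.
move=> triv u u0.
have u_in : u \in ker_pred (delta i.+1) by rewrite unfold_in u0.
by apply: (hclass_eq0 (delta i) (Sub u u_in)).1; exact: triv.
Qed.

(** The next term is zero, so everything in the last degree is a cocycle and the cohomology there is
    a cokernel. *)
Lemma ExtD_last m : injres_length_le I m.+1 ->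
  exists beta : {linear nuinv (I m.+1) -> ExtD I m.+1},
    (forall y, exists u, y = beta u) /\
    (forall u, beta u = 0 <-> exists w, delta m w = u).
Proof.
move=> I_length.
have u_in (u : nuinv (I m.+1)) : u \in ker_pred (delta m.+1).
  by rewrite unfold_in; apply/eqP; apply: nuinv_ext => g; exact: (I_length m.+2).
pose b u : ExtD I m.+1 := hclass (delta m) (Sub u (u_in u)).
have blin : linear b.
  move=> a u v; rewrite /b -hclass_linear; congr (hclass _ _).
  by apply: val_inj; rewrite linearP.
exists (mklin blin); split=> [y|u] /=; last exact: hclass_eq0.
have [z ->] := hclass_surj y; exists (val z); rewrite /= /b; congr (hclass _ _).
exact: val_inj.
Qed.

(** The composite of [h] with the projection [beta] comes from a map [G] from the last term to
    [D L]. It kills boundaries, so [G] composed with the last differential is zero by faithfulness;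
    that differential is onto, so [G = 0], and functionals separate the elements of [L]. *)
Lemma ExtD_to_alg0 m (h : ExtD I m.+1 -> L) : injres_length_le I m.+1 ->
  (forall x y, h (x + y) = h x + h y) ->
  (forall (a : L) x, h ((a : L^c) *: x) = h x * a) -> forall x, h x = 0.
Proof.
move=> I_length hD hZ; have [beta [bsurj bker]] := ExtD_last I_length.
have h0 : h 0 = 0 by have := hD 0 0; rewrite addr0 => /eqP; rewrite -subr_eq subrr => /eqP.
have [G GP] := @nuinv_factor _ _ _ L_findim (I m.+1) (h \o beta)
  (fun u v => etrans (congr1 h (linearD beta u v)) (hD _ _))
  (fun a u => etrans (congr1 h (linearZ_LR beta _ _)) (hZ _ _)) (irfg _ _) (@irinj _ _ _ _).
have G0 : forall x, (G \o d m) x = 0.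
  apply: nuinv_faithful => //; [exact: irfg|exact: irinj|move=> u g].
  have := GP (delta m u) g; rewrite /= => ->.
  have -> : beta (delta m u) = 0 by apply/bker; exists u.
  by rewrite h0; apply: dual_ext => y /=; rewrite mulr0 linear0.
move=> x; have [u ->] := bsurj x.
apply: dual_separates => // g.
have := congr1 (fun f : dual R => f 1) (GP u g).
have [y ->] := injres_last_surj I_length (u g).
by rewrite /= mul1r => <-; have := G0 y; rewrite /= => ->.
Qed.

(** If the cokernel vanished, the last differential would have a section [G]. A nonzero image of [G]
    would contain a nonzero cocycle by minimality, yet the differential is injective on it. So the
    last term would be zero and the resolution too short. *)
Lemma ExtD_nontrivial m : minimal_injres I -> injres_length_le I m.+1 ->
  (forall p, (p < m.+1)%N -> ~ exists C : injres M, injres_length_le C p) ->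
  ~ trivial_mod (ExtD I m.+1).
Proof.
move=> I_min I_length I_dim triv; have [beta [bsurj bker]] := ExtD_last I_length.
have surj u : exists w, delta m w = u by apply/bker; exact: triv.
have [G GP] := @nuinv_lift _ _ _ L_findim (I m.+1) (I m) (nuinv (I m.+1)) idfun (delta m)
  (irfg _ _) (@irinj _ _ _ _) surj.
have dG x : d m (G x) = x.
  apply: (@nuinv_faithful2 _ _ _ L_findim _ _ (d m \o G) idfun
    (irfg _ _) (@irinj _ _ _ _) _ x) => u g.
  exact: (congr1 (fun f : nuinv (I m.+1) => f g) (GP u)).
apply: (I_dim m) => //; exists I => p; rewrite leq_eqVlt => /orP[/eqP <-|]; last exact: I_length.
move=> x; apply/eqP/negPn/negP => x0.
pose N : {pred I m} := fun y => `[< exists z, y = G z >].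
have Nsub : submod_closed N.
  split=> [|c y z]; rewrite !unfold_in.
    by apply/asboolP; exists 0; rewrite linear0.
  move=> /asboolP[u ->] /asboolP[v ->]; apply/asboolP; exists (c *: u + v).
  by rewrite linearP.
have [|z [/asboolP[y ->] /eqP ne]] := injres_essential I_min Nsub.
  exists (G x); first by apply/asboolP; exists x.
  by apply: contraNneq x0 => Gx; rewrite -(dG x) Gx linear0.
by rewrite dG => y0; apply: ne; rewrite y0 linear0.
Qed.

(** * Endomorphisms of the top extension module are scalars *)

Section Scalars.
Variable m : nat.
Hypothesis I_exact : forall i, (i < m)%N -> trivial_mod (ExtD I i.+1).
Hypothesis M_scalar : forall g : {linear M -> M}, exists c : K, forall x, g x = scal R c *: x.

Let hom_sub_scal (V : lmodType L^c) (G : {linear V -> V}) (c : K) : Defs.Hom V V :=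
  homD (G : Defs.Hom V V) (homN (end_scale c (end1 V))).

(* a self-map of the complex that extends to the next term is homotopic to a scalar *)
Lemma injres_chain_scalar i (G : {linear I i -> I i}) (H : {linear I i.+1 -> I i.+1}) :
  (i <= m)%N -> (forall x, d i (G x) = H (d i x)) ->
  exists (c : K) (s : {linear I i.+1 -> I i}),
    forall x, H (d i x) - scal R c *: d i x = d i (s (d i x)).
Proof.
elim: i G H => [|i IH] G H im GH.
  (* In degree 0, [G] preserves the kernel of the differential, that is, the image of [M], and
     induces there an endomorphism, which is a scalar. *)
  have augP x : exists y, G (iraug I x) = iraug I y.
    by have [|y ->] := irexact0 (x := G (iraug I x));
      [rewrite GH iraugK linear0|exists y].
  have [g gP] := choice augP.
  have glin : linear g.
    by move=> a x y; apply: (@iraug_inj _ _ I); rewrite -gP !linearP -!gP.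
  have [c cP] := M_scalar (mklin glin).
  have [|s sP] := @injective_mod_extend _ (I 0%N) _ _ (d 0%N) (hom_sub_scal G c)
    (@irinj _ _ _ _) (irfg _ _) (irfg _ _).
    move=> x /irexact0[y ->]; change (G (iraug I y) - scal R c *: iraug I y = 0).
    by rewrite gP -linearZ -cP subrr.
  exists c, s => x; rewrite sP.
  change (H (d 0%N x) - scal R c *: d 0%N x = d 0%N (G x - scal R c *: x)).
  by rewrite linearB GH (linearZ_LR (d 0%N)).
(* Vanishing of [Ext] in degree [i.+1] makes the complex under [nu^-] exact there, so [G] lifts one
   degree down. *)
have [|G' G'P] := @nuinv_lift _ _ _ L_findim (I i) (I i) (nuinv (I i.+1))
  (nuinv_map G \o delta i) (delta i) (irfg _ _) (@irinj _ _ _ _).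
  move=> u; apply: ExtD_exact; first exact: I_exact.
  by apply: nuinv_ext => g /=; rewrite GH cdiffK linear0.
have {G'P} G'P x : d i (G' x) = G (d i x).
  apply: (@nuinv_faithful2 _ _ _ L_findim _ _ (d i \o G') (G \o d i)
    (irfg _ _) (@irinj _ _ _ _) _ x) => u g.
  exact: (congr1 (fun f : nuinv (I i.+1) => f g) (G'P u)).
have [c [s sP]] := IH G' G (ltnW im) G'P.
(* By induction [G - c - d s] vanishes on the image of the previous differential, which is the
   kernel of the next one, and hence factors through the latter as [s']. *)
pose E : Defs.Hom (I i.+1) (I i.+1) := 
  homD (hom_sub_scal G c) (homN ((d i \o s) : {linear _ -> _})).
have [|s' s'P] := @injective_mod_extend _ (I i.+1) _ _ (d i.+1) E
    (@irinj _ _ _ _) (irfg _ _) (irfg _ _).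
  move=> x /irexactS[y ->].
  change (G (d i y) - scal R c *: d i y - d i (s (d i y)) = 0).
  by rewrite sP subrr.
exists c, s' => x; rewrite s'P.
change (H (d i.+1 x) - scal R c *: d i.+1 x =
        d i.+1 (G x - scal R c *: x - d i (s x))).
by rewrite !linearB GH (linearZ_LR (d i.+1)) cdiffK subr0.
Qed.

(** An endomorphism of the cokernel lifts to [H] on the last term; as it preserves boundaries, it
    lifts further to [G] one degree below. The homotopy for this pair shows that [H - c] has its
    image under [nu^-] inside the boundaries. *)
Lemma ExtD_scalar : injres_length_le I m.+1 ->
  forall g : {linear ExtD I m.+1 -> ExtD I m.+1},
  exists c : K, forall y, g y = scal R c *: y.
Proof.
move=> I_length g; have [beta [bsurj bker]] := ExtD_last I_length.
have [|H HP] := @nuinv_lift _ _ _ L_findim (I m.+1) (I m.+1) _ (g \o beta) beta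
  (irfg _ _) (@irinj _ _ _ _).
  by move=> u; have [w e] := bsurj (g (beta u)); exists w; exact: esym e.
have [|G GP] := @nuinv_lift _ _ _ L_findim (I m) (I m) (nuinv (I m.+1))
  (nuinv_map H \o delta m) (delta m) (irfg _ _) (@irinj _ _ _ _).
  move=> u; apply/bker; rewrite [LHS]HP /=.
  have -> : beta (delta m u) = 0 by apply/bker; exists u.
  by rewrite linear0.
have {GP} GP x : d m (G x) = H (d m x).
  apply: (@nuinv_faithful2 _ _ _ L_findim _ _ (d m \o G) (H \o d m)
    (irfg _ _) (@irinj _ _ _ _) _ x) => u f.
  exact: (congr1 (fun h : nuinv (I m.+1) => h f) (GP u)).
have [c [s sP]] := injres_chain_scalar (leqnn m) GP.
exists c => y; have [u ->] := bsurj y.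
have -> : g (beta u) = beta (nuinv_map H u) by rewrite HP.
rewrite -linearZ; apply/eqP; rewrite -subr_eq0 -linearB; apply/eqP/bker.
exists (nuinv_map s u); apply: nuinv_ext => f.
change (d m (s (u f)) = H (u f) - u (dual_lmul (scal R c) f)).
(* Central scalars act on [D L] in the same way from both sides. *)
have -> : dual_lmul (scal R c) f = scal R c *: f.
  apply: dual_ext => x; change (f (x * (c *: (1 : L))) = f ((c *: (1 : L)) * x)).
  by rewrite -quotalg_scaleAr -quotalg_scaleAl mulr1 mul1r.
have -> : u (scal R c *: f) = scal R c *: u f by exact: (linearZ_LR u).
(* The homotopy identity holds on the image of the last differential, which is the whole last
   term. *)
by have [x ->] := injres_last_surj I_length (u f); rewrite -sP.
Qed.

End Scalars.
End NAPRTheory.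

(** * Elements supported on one summand, inverses of linear bijections *)

Lemma dsum_single (R : pzRingType) (T : finType) (M : T -> lmodType R) t (x : M t) :
  exists y : dsum M, y t = x /\ forall s, s != t -> y s = 0.
Proof.
exists (fun s => match pselect (t = s) with
  | left e => ecast s (M s) e x
  | right _ => 0 end); split.
  by case: pselect => // e; rewrite (Prop_irrelevance e erefl).
by move=> s /eqP st; case: pselect => // e; case: st.
Qed.

Lemma bijective_linear_inv (R : pzRingType) (U V : lmodType R) (f : {linear U -> V}) :
  bijective f -> exists g : {linear V -> U}, cancel f g /\ cancel g f.
Proof.
move=> [g fK gK]; have glin : linear g.
  by move=> a x y; apply: (can_inj fK); rewrite linearP !gK.
by exists (mklin glin).
Qed.

(** * Characters of a bound quiver algebra *)

Section PathCoefficients.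
Variables (K : fieldType) (Q : quiver).
Local Notation KQ := (pathalg K Q).
Implicit Types (x y : KQ) (v w : vert Q) (p q : qpath Q).

Lemma mcoeff_pelt p q : (pelt K p : KQ)@_q = (p == q)%:R.
Proof. by rewrite pelt.unlock mcoeffU. Qed.

(** A concatenation of paths is trivial only if both factors are, so the coefficient at a trivial
    path is multiplicative. *)
Lemma triv_coefM v x y : (x * y)@_(triv_path v) = x@_(triv_path v) * y@_(triv_path v).
Proof.
have lin1 z : linear (fun x : KQ => (x * z)@_(triv_path v) : K^o).
  by move=> c a b; rewrite mulrDl -pathalg_scaleAl mcoeffD mcoeffZ.
have lin2 z : linear (fun x : KQ => (z * x)@_(triv_path v) : K^o).
  by move=> c a b; rewrite mulrDr -pathalg_scaleAr mcoeffD mcoeffZ.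
have lin3 (z : K) : linear (fun x : KQ => x@_(triv_path v) * z : K^o).
  by move=> c a b; rewrite mcoeffD mcoeffZ mulrDl -mulrA.
have lin4 (z : K) : linear (fun x : KQ => z * x@_(triv_path v) : K^o).
  by move=> c a b; rewrite mcoeffD mcoeffZ mulrDr mulrCA.
apply: (@pathalg_ext K Q K^o (mklin (lin1 y)) (mklin (lin3 _))) => p /=.
apply: (@pathalg_ext K Q K^o (mklin (lin2 _)) (mklin (lin4 _))) => q /=.
rewrite pelt_mul pmul.unlock !mcoeff_pelt.
have [e|ne] := pselect (pend p = pstart q); last first.
  rewrite pcatN // [oapp _ _ _]/= mcoeff0 -natrM.
  by case: eqP => [pv|_]; case: eqP => [qv|_] //; case: ne; rewrite pv qv.
have [r [-> rs re ra]] := pcat_ex e; rewrite [oapp _ _ _]/=.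
rewrite mcoeff_pelt -natrM mulnb; congr (nat_of_bool _)%:R.
apply/eqP/andP => [rv|[/eqP pv /eqP qv]].
  have : size (parrows p ++ parrows q) = 0%N by rewrite -ra rv.
  rewrite size_cat => /eqP; rewrite addn_eq0 !size_eq0 => /andP[/eqP p0 /eqP q0].
  have ps : pstart p = v by rewrite -rs rv.
  split; apply/eqP; apply: qpath_eq => //.
  by rewrite -e /pend p0 /= ps.
by apply: qpath_eq; rewrite ?rs ?ra pv // qv.
Qed.

Lemma mulr_trivE v p :
  (pelt K (triv_path v) : KQ) * pelt K p = if v == pstart p then pelt K p else 0.
Proof. by rewrite pelt_mul pmul.unlock pcat1p; case: eqP. Qed.

Lemma mul_trivrE v p :
  (pelt K p : KQ) * pelt K (triv_path v) = if pend p == v then pelt K p else 0.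
Proof. by rewrite pelt_mul pmul.unlock pcatp1; case: eqP. Qed.

Lemma triv_idem v w : (pelt K (triv_path v) : KQ) * pelt K (triv_path w) =
  if v == w then pelt K (triv_path v) else 0.
Proof. by rewrite mul_trivrE. Qed.

Lemma msupp_sum x : x = \sum_(p <- msupp x) x@_p *: pelt K p.
Proof.
rewrite {1}(monalgE x); apply: eq_bigr => p _; apply/malgP => q.
by rewrite mcoeffZ mcoeff_pelt mcoeffU mulr_natr.
Qed.

Lemma mul_triv_start x v : (forall p, p \in msupp x -> pstart p = v) ->
  (pelt K (triv_path v) : KQ) * x = x.
Proof.
move=> xv; rewrite [RHS]msupp_sum [in LHS](msupp_sum x) mulr_sumr.
rewrite big_seq [RHS]big_seq; apply: eq_bigr => p /xv px.
by rewrite -pathalg_scaleAr mulr_trivE px eqxx.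
Qed.

Lemma mul_triv_end x v : (forall p, p \in msupp x -> pend p = v) ->
  x * (pelt K (triv_path v) : KQ) = x.
Proof.
move=> xv; rewrite [RHS]msupp_sum [in LHS](msupp_sum x) mulr_suml.
rewrite big_seq [RHS]big_seq; apply: eq_bigr => p /xv px.
by rewrite -pathalg_scaleAl mul_trivrE px eqxx.
Qed.

Lemma sink_start k p : is_sink k -> pstart p = k -> p = triv_path k.
Proof.
move=> k_sink pk; apply: qpath_eq => //; case: p pk => -[i [|a s]] //= w ik.
by have /andP[/eqP ai _] := w; move: (k_sink a); rewrite ai -ik eqxx.
Qed.

(** Only the trivial path starts at a sink, so [e_k KQ] is one-dimensional. *)
Lemma mul_triv_sink k x : is_sink k ->
  (pelt K (triv_path k) : KQ) * x = x@_(triv_path k) *: pelt K (triv_path k).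
Proof.
move=> k_sink.
have lin1 : linear (fun x : KQ => pelt K (triv_path k) * x).
  by move=> c a b; rewrite mulrDr -pathalg_scaleAr.
have lin2 : linear (fun x : KQ => x@_(triv_path k) *: pelt K (triv_path k)).
  by move=> c a b; rewrite mcoeffD mcoeffZ scalerDl scalerA.
apply: (@pathalg_ext K Q _ (mklin lin1) (mklin lin2)) => p /=.
rewrite mulr_trivE mcoeff_pelt; case: eqP => [kp|kp].
  by rewrite {2}(sink_start k_sink (esym kp)) eqxx scale1r -(sink_start k_sink (esym kp)).
by case: eqP => [pk|_]; [case: kp; rewrite pk|rewrite scale0r].
Qed.

Lemma ideal_sub (S : set KQ) (P : set KQ) : two_sided_ideal P ->
  (forall r, S r -> P r) -> forall x, ideal S x -> P x.
Proof. by move=> iP SP x; apply: smallest_sub. Qed.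

Lemma ideal_gen (S : set KQ) x : S x -> ideal S x.
Proof. exact: sub_gen_smallest. Qed.

End PathCoefficients.

Section Characters.
Variables (K : fieldType) (Q : quiver) (R : set (pathalg K Q)).
Hypothesis R_relation : forall r, R r -> is_relation r.
Local Notation L := (quotalg R).
Local Notation D := (dual R : lmodType L^c).
Implicit Types (a : L) (v w : vert Q).

Lemma relation_triv_coef (r : pathalg K Q) v : is_relation r -> r@_(triv_path v) = 0.
Proof.
move=> [i [j rP]]; apply: mcoeff_outdom; apply/negP => /rP[_ _].
by rewrite /plength.
Qed.

(** Relations involve no trivial paths, and the kernel of a multiplicative functional is an
    ideal. *)
Lemma ideal_triv_coef x v : ideal R x -> x@_(triv_path v) = 0.
Proof.
move=> Rx; apply: (@ideal_sub K Q R (fun y => y@_(triv_path v) = 0) _ _ x Rx).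
  split=> [|y z y0 z0|y z z0]; first exact: mcoeff0.
    by rewrite mcoeffD y0 z0 addr0.
  by split; rewrite triv_coefM z0 ?mulr0 ?mul0r.
by move=> r Rr; apply: relation_triv_coef; exact: R_relation.
Qed.

(** The character through which [L] acts on the simple module [S_v]. It is read off a chosen
    representative; the choice is immaterial because the ideal has no coefficients at trivial
    paths. *)
Definition chi_fun v a : K^o := (repr (a : quotmod _) : pathalg K Q)@_(triv_path v).

Lemma chi_funE v x : chi_fun v (qpi R x) = x@_(triv_path v).
Proof.
apply/eqP; rewrite -subr_eq0 -mcoeffB; apply/eqP; apply: ideal_triv_coef.
by apply/qpi_eq; exact: (reprK (qpi R x : quotmod _)).
Qed.

Fact chi_linear v : linear (chi_fun v).
Proof.
move=> c a b; have [x ->] := qpi_surj a; have [y ->] := qpi_surj b.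
by rewrite -linearP !chi_funE mcoeffD mcoeffZ.
Qed.

Definition chi v : dual R := mklin (chi_linear v).

Lemma chiE v x : chi v (qpi R x) = x@_(triv_path v).
Proof. exact: chi_funE. Qed.

Lemma chiM v a (b : L) : chi v (a * b) = chi v a * chi v b.
Proof.
have [x ->] := qpi_surj a; have [y ->] := qpi_surj b.
by rewrite -rmorphM !chiE triv_coefM.
Qed.

Lemma chi_idem v w : chi v (idem R w) = (w == v)%:R.
Proof.
rewrite chiE mcoeff_pelt; congr (nat_of_bool _)%:R; apply/eqP/eqP => [|-> //].
exact: (congr1 (@pstart Q)).
Qed.

Lemma sum_idem : \sum_v idem R v = 1.
Proof. by rewrite -linear_sum. Qed.

Lemma idem_sink k a : is_sink k -> idem R k * a = chi k a *: idem R k.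
Proof.
move=> k_sink; have [x ->] := qpi_surj a.
by rewrite chiE /idem -rmorphM mul_triv_sink //; exact: linearZ_LR.
Qed.

(* the socle elements of type S_v *)
Definition chi_eigen (M : lmodType L^c) v (y : M) : Prop :=
  forall a, (a : L^c) *: y = scal R (chi v a) *: y.

Lemma chi_eigen_map (M N : lmodType L^c) (f : {linear M -> N}) v y :
  chi_eigen v y -> chi_eigen v (f y).
Proof. by move=> ey a; rewrite -!linearZ_LR ey. Qed.

Lemma chi_eigen_dual v : chi_eigen v (chi v : D).
Proof.
move=> a; apply: dual_ext => x; rewrite dual_scalE.
by change (chi v (a * x) = chi v a * chi v x); rewrite chiM.
Qed.

Lemma chi_eigen_idem (M : lmodType L^c) v (y : M) : chi_eigen v y -> (idem R v : L^c) *: y = y.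
Proof. by move=> ->; rewrite chi_idem eqxx /scal !scale1r. Qed.

(** * Socle elements in a minimal injective resolution *)

Section Resolution.
Variables (M : lmodType L^c) (I : injres M).
Hypothesis I_minimal : minimal_injres I.

(** The line spanned by [y] is a submodule, so by minimality it contains a nonzero cocycle, and all
    of it consists of multiples of that cocycle. *)
Lemma chi_eigen_cdiff i v (y : I i) : chi_eigen v y -> cdiff I i y = 0.
Proof.
move=> ey; have [->|y0] := eqVneq y 0; first exact: linear0.
pose N : {pred I i} := fun z => `[< exists c : K, z = scal R c *: y >].
have Nsub : submod_closed N.
  split=> [|a x z]; rewrite !unfold_in.
    by apply/asboolP; exists 0; rewrite /scal !scale0r.
  move=> /asboolP[c ->] /asboolP[c' ->]; apply/asboolP; exists (c * chi v a + c').
  have -> : a *: (scal R c *: y) = scal R (c * chi v a) *: y.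
    by rewrite scalerA -scal_central -scalerA (ey a) scalerA scalM.
  by rewrite -scalerDl /scal -scalerDl.
have [|z [/asboolP[c ->] ne dz]] := injres_essential I_minimal Nsub.
  exists y => //; apply/asboolP; exists 1; by rewrite /scal !scale1r.
have c0 : c != 0 by apply: contraNneq ne => ->; rewrite /scal !scale0r.
rewrite -[y](scale1r) -[1]/(1 : L) -(scale1r (1 : L)) -(mulVf c0).
change (cdiff I i (scal R (c^-1 * c) *: y) = 0).
by rewrite -scalM -scalerA linearZ_LR dz scaler0.
Qed.

(** Such a [y] is a cocycle, hence a boundary [d x]. As [e_k L] is one-dimensional, [x e_k] is again
    a socle element of type [S_k] and is killed by [d]; but [y = y e_k = d (x e_k)]. *)
Lemma chi_eigen_sink k i (y : I i.+1) : is_sink k -> chi_eigen k y -> y = 0.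
Proof.
move=> k_sink ey; have [x yx] := irexactS (chi_eigen_cdiff ey).
have ex : chi_eigen k ((idem R k : L^c) *: x).
  move=> a; rewrite !scalerA; congr (_ *: _).
  change (idem R k * a = idem R k * (chi k a *: (1 : L))).
  by rewrite -quotalg_scaleAr mulr1 idem_sink.
by rewrite -(chi_eigen_idem ey) yx -linearZ_LR (chi_eigen_cdiff ex).
Qed.

End Resolution.

(** * Reading coordinates of [nu^- J] off the socle of [J] *)

Section Coordinates.
Hypothesis L_findim : fingen (L : lmodType K).
Variables (J : lmodType L^c) (B : finType) (i : B -> vert Q).
Variables (phi : {linear dsum (fun b => Pmod R (i b)) -> nuinv J}).
Hypotheses (J_fingen : fingen J) (J_inj : injective_mod J) (phi_bij : bijective phi).

(** The coordinate [b] on [nu^- J] is induced by a map [G] from [J] to [D L]. Applying [G] to the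
    value of [phi z] at [chi v] and evaluating at 1 gives [chi v] of the coordinate. *)
Lemma coord_chi z b v : phi z (chi v) = 0 -> chi v (Pval (z b)) = 0.
Proof.
have [phi' [phiK phi'K]] := bijective_linear_inv phi_bij.
have [||G GP] := @nuinv_factor _ _ _ L_findim J (fun u => Pval (phi' u b)) _ _ J_fingen J_inj.
- by move=> u u'; rewrite linearD PvalD.
- by move=> a u; rewrite linearZ_LR PvalZ.
move=> z0; have := congr1 (fun f : dual R => f 1) (GP (phi z) (chi v)).
by rewrite z0 linear0 phiK /= mul1r => <-.
Qed.

(** The unit vector of the summand [b]: its coordinate has character value 1, so its value at
    [chi (i b)] is a nonzero socle element of [J] of type [S_(i b)]. *)
Lemma coord_vertex b : exists z, Pval (z b) = idem R (i b) /\
  (forall b', b' != b -> Pval (z b') = 0) /\ phi z (chi (i b)) <> 0.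
Proof.
have [x xE] := Pval_ex (i b) (1 : L); rewrite mulr1 in xE.
have [z [zb zN]] := @dsum_single _ _ (fun b => Pmod R (i b)) b x.
exists z; split; first by rewrite zb.
split=> [b' /zN ->|/(coord_chi b)]; first exact: (linear0 (val : Pmod R (i b') -> L)).
by rewrite zb xE chi_idem eqxx => /eqP; rewrite oner_eq0.
Qed.

End Coordinates.
End Characters.

(** * The path algebra of the mutated quiver *)

(* a sealed copy of mut_embed: it keeps failing conversion tests from unfolding
   the sum over the support *)
HB.lock Definition mut_emb (K : fieldType) (Q : quiver) (k : vert Q) (C : finType)
  (j : C -> vert Q) (x : pathalg K Q) : pathalg K (mut_quiver k j) := mut_embed k j x.
Arguments mut_emb {K Q k C j} x.

Section Components.
Variables (K : fieldType) (Q : quiver) (k : vert Q) (C : finType) (j : C -> vert Q).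
Local Notation Q' := (mut_quiver k j).
Local Notation KQ := (pathalg K Q).
Implicit Types (q : qpath Q').

Definition unmut_arrow (a : arr Q') : option (arr Q) :=
  if a is inl b then Some (val b) else None.

(** When [k] is a sink of [Q] and no [j c] equals [k], a path of [Q'] that starts away from [k]
    contains no new arrow, so dropping the new arrows changes nothing and the default 0 of [insub]
    never occurs. *)
Definition res_path q : KQ :=
  if pstart q == k then 0 else
  oapp (pelt K) 0 (insub (pstart q : vert Q, pmap unmut_arrow (parrows q)) : option (qpath Q)).

(** Strips a leading new arrow with index [c]; all other paths have coordinate 0. *)
Definition coord_path c q : KQ :=
  if parrows q is a :: s then
    if a == inr c then
      oapp (pelt K) 0 (insub (j c, pmap unmut_arrow s) : option (qpath Q))
    else 0
  else 0.

End Components.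

(* the components of KQ' = K e_k + sum_c star c KQ + (1 - e_k) KQ (1 - e_k) *)
HB.lock Definition mut_res (K : fieldType) (Q : quiver) (k : vert Q) (C : finType)
  (j : C -> vert Q) (z : pathalg K (mut_quiver k j)) : pathalg K Q :=
  mext (@res_path K Q k C j) z.
Arguments mut_res {K Q k C j} z.

HB.lock Definition mut_coord (K : fieldType) (Q : quiver) (k : vert Q) (C : finType)
  (j : C -> vert Q) (c : C) (z : pathalg K (mut_quiver k j)) : pathalg K Q :=
  mext (@coord_path K Q k C j c) z.
Arguments mut_coord {K Q k C j} c z.

Section MutatedPaths.
Variables (K : fieldType) (Q : quiver) (k : vert Q) (C : finType) (j : C -> vert Q).
Hypotheses (k_sink : is_sink k) (j_neq : forall c, j c != k).
Local Notation Q' := (mut_quiver k j).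
Local Notation KQ := (pathalg K Q).
Local Notation KQ' := (pathalg K Q').
Local Notation embed := (@mut_emb K Q k C j).
Local Notation star c := (@star Q k C j K c).
Local Notation marrow := (@mut_arrow Q k C j).
Local Notation mpath := (@mut_path Q k C j).
Implicit Types (p : qpath Q) (q : qpath Q') (x : KQ) (z : KQ').

Lemma mut_embE x : mut_embed k j x = embed x.
Proof. by rewrite mut_emb.unlock. Qed.

Fact mut_embed_linear : linear embed.
Proof. by rewrite mut_emb.unlock; exact: mext_linear. Qed.
HB.instance Definition _ := GRing.isLinear.Build K KQ KQ' *:%R embed mut_embed_linear.

Lemma mut_embed_pelt p : embed (pelt K p) = oapp (pelt K) 0 (mpath p).
Proof. by rewrite mut_emb.unlock /mut_embed pelt.unlock mextU. Qed.

Lemma mut_arrowE (a : arr Q) (ak : tgt a != k) : marrow a = Some (inl (Sub a ak)).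
Proof. by rewrite /mut_arrow insubT. Qed.

Section Survive.
Variable s : seq (arr Q).
Hypothesis s_survives : all (fun a => tgt a != k) s.

Lemma unmut_arrowsK : pmap (@unmut_arrow Q k C j) (pmap marrow s) = s.
Proof.
elim: s s_survives => //= a t IH /andP[ak tk].
by rewrite mut_arrowE /= IH.
Qed.

Lemma mut_arrows_composable (i : vert Q) :
  @composable Q' i (pmap marrow s) = composable i s.
Proof.
elim: s s_survives i => //= a t IH /andP[ak tk] i.
by rewrite mut_arrowE /= IH.
Qed.

Lemma mut_arrows_tgt : map (@tgt Q') (pmap marrow s) = map (@tgt Q) s.
Proof.
elim: s s_survives => //= a t IH /andP[ak tk].
by rewrite mut_arrowE /= IH.
Qed.

Lemma size_mut_arrows : size (pmap marrow s) = size s.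
Proof. by have := congr1 size mut_arrows_tgt; rewrite !size_map. Qed.

Lemma mut_arrows_head c t : pmap marrow s <> inr c :: t.
Proof.
by case: s s_survives => //= a t' /andP[ak tk]; rewrite mut_arrowE.
Qed.

End Survive.

Lemma mut_pathT p : all (fun a => tgt a != k) (parrows p) -> exists q,
  [/\ mpath p = Some q, pstart q = pstart p, pend q = pend p &
      parrows q = pmap marrow (parrows p)].
Proof.
move=> ps; have w : @composable Q' (pstart p) (pmap marrow (parrows p)).
  by rewrite mut_arrows_composable //; exact: (valP p).
exists (@QPath Q' (pstart p, pmap marrow (parrows p)) w); split=> //.
  by rewrite /mut_path ps insubT.
by rewrite /pend /= mut_arrows_tgt.
Qed.

Lemma mut_pathN p : ~~ all (fun a => tgt a != k) (parrows p) -> mpath p = None.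
Proof. by rewrite /mut_path => /negbTE ->. Qed.

Lemma mut_path_end p : plength p != 0%N -> pend p = k -> mpath p = None.
Proof.
move=> p0 pk; apply: mut_pathN; move: p0 pk; rewrite /plength /pend.
case/lastP: (parrows p) => // s a _; rewrite map_rcons last_rcons all_rcons => ->.
by rewrite eqxx.
Qed.

(** No arrow leaves the sink, so an arrow into [k] can only be the last one of a path. *)
Lemma path_survives i s : composable i s -> last i (map (@tgt Q) s) != k ->
  all (fun a => tgt a != k) s.
Proof.
elim: s i => //= a s IH i /andP[_ sa] sk; rewrite (IH _ sa sk) andbT.
apply: contraNneq sk => ak; case: s sa {IH} => [|b s] /=; first by rewrite ak.
by move=> /andP[/eqP ba _]; move: (k_sink b); rewrite ba ak eqxx.
Qed.

Lemma qpath_survives p : pend p != k -> all (fun a => tgt a != k) (parrows p).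
Proof. exact: (path_survives (valP p)). Qed.

(** New arrows start at [k] and old arrows of [Q'] never end there, so a path that begins elsewhere
    uses old arrows only. *)
Lemma mut_composable_inv (i : vert Q) (s : seq (arr Q')) : i != k -> @composable Q' i s ->
  exists t, [/\ s = pmap marrow t, all (fun a => tgt a != k) t & composable i t].
Proof.
elim: s i => [|a s IH] i ik; first by exists [::].
case: a => [b|c] /= /andP[/eqP bi bs]; last by rewrite bi eqxx in ik.
have [t [-> tk tb]] := IH _ (valP b) bs.
exists (val b :: t); split=> /=; rewrite ?(valP b) ?bi ?eqxx //.
by rewrite /mut_arrow valK.
Qed.

Lemma mut_path_inv q : pstart q != k -> exists2 p, mpath p = Some q & pend p != k.
Proof.
move=> qk; have [t [qt tk tc]] := mut_composable_inv qk (valP q).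
have [q' [e es ee ea]] := @mut_pathT (@QPath Q (pstart q, t) tc) tk.
have qq : q' = q by apply: qpath_eq; rewrite ?es // ea /parrows /= -qt.
exists (@QPath Q (pstart q, t) tc); first by rewrite e qq.
rewrite /pend /parrows /pstart /=; elim/last_ind: t tk {qt tc e ee ea q' qq es} => [|t a _] //.
by rewrite all_rcons map_rcons last_rcons => /andP[].
Qed.

Lemma mut_embed_triv i : embed (pelt K (triv_path i)) = pelt K (@triv_path Q' i).
Proof.
rewrite mut_embed_pelt; have [|q [-> qs _ qa]] := @mut_pathT (triv_path i) => //.
by rewrite /=; congr (pelt K _); apply: qpath_eq.
Qed.

Lemma mut_embed1 : embed 1 = 1.
Proof. by rewrite linear_sum; apply: eq_bigr => i _; exact: mut_embed_triv. Qed.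

(** Checked on pairs of paths: a concatenation uses an arrow into [k] exactly when one of its
    factors does, and end vertices are preserved. *)
Lemma mut_embedM : {morph embed : x y / x * y}.
Proof.
move=> x y.
have lin1 y' : linear (fun x => embed (x * y')).
  by move=> c a b; rewrite mulrDl -pathalg_scaleAl linearP.
have lin2 x' : linear (fun y => embed (x' * y)).
  by move=> c a b; rewrite mulrDr -pathalg_scaleAr linearP.
have lin3 z : linear (fun x => embed x * z).
  by move=> c a b; rewrite linearP mulrDl -pathalg_scaleAl.
have lin4 z : linear (fun x => z * embed x).
  by move=> c a b; rewrite linearP mulrDr -pathalg_scaleAr.
apply: (@pathalg_ext K Q _ (mklin (lin1 y)) (mklin (lin3 _))) => p /=.
apply: (@pathalg_ext K Q _ (mklin (lin2 _)) (mklin (lin4 _))) => p' /=.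
rewrite !mut_embed_pelt pelt_mul pmul.unlock.
have [e|ne] := pselect (pend p = pstart p'); last first.
  rewrite pcatN // [oapp _ _ None]/= linear0.
  have [/mut_pathT[q [-> _ qe _]]|/mut_pathN ->] := boolP (all (fun a => tgt a != k) (parrows p));
    last by rewrite mul0r.
  have [/mut_pathT[q' [-> qs _ _]]|/mut_pathN ->] := boolP (all (fun a => tgt a != k) (parrows p'));
    last by rewrite mulr0.
  by rewrite /= pelt_mul pmul.unlock pcatN // qe qs.
have [r [-> rs re ra]] := pcat_ex e; rewrite [oapp _ _ (Some r)]/= mut_embed_pelt.
have [pS|pN] := boolP (all (fun a => tgt a != k) (parrows p)); last first.
  by rewrite [mpath r]mut_pathN ?[mpath p]mut_pathN ?mul0r // ra all_cat negb_and pN.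
have [q [-> q1 qe q2]] := mut_pathT pS.
have [p'S|pN] := boolP (all (fun a => tgt a != k) (parrows p')); last first.
  by rewrite [mpath r]mut_pathN ?[mpath p']mut_pathN ?mulr0 // ra all_cat negb_and pN orbT.
have [q' [-> q1' _ q3']] := mut_pathT p'S.
have rS : all (fun a => tgt a != k) (parrows r) by rewrite ra all_cat p'S pS.
have [r' [-> r1 _ r3]] := mut_pathT rS.
rewrite /= pelt_mul pmul.unlock; have [|u [-> us _ ua]] := @pcat_ex _ q q'; first by rewrite qe q1'.
by rewrite /=; congr (pelt K _); apply: qpath_eq; rewrite ?us ?ua ?r1 ?r3 ?q1 ?q2 ?q3' ?ra ?pmap_cat.
Qed.

Local Notation e_k := (pelt K (triv_path k) : KQ).
Local Notation e'_k := (pelt K (@triv_path Q' k) : KQ').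

(** Of the paths that survive, only the trivial one ends at [k]. *)
Lemma mut_embed_mul_source x : embed x * e'_k = x@_(triv_path k) *: e'_k.
Proof.
have lin1 : linear (fun x => embed x * e'_k).
  by move=> c a b; rewrite linearP mulrDl -pathalg_scaleAl.
have lin2 : linear (fun x : KQ => x@_(triv_path k) *: e'_k).
  by move=> c a b; rewrite mcoeffD mcoeffZ scalerDl scalerA.
apply: (@pathalg_ext K Q _ (mklin lin1) (mklin lin2)) => p /=.
rewrite mcoeff_pelt; have [->|pk] := eqVneq p (triv_path k).
  by rewrite mut_embed_triv mul_trivrE eqxx scale1r.
rewrite scale0r mut_embed_pelt; have [pe|pe] := eqVneq (pend p) k.
  rewrite mut_path_end ?mul0r //; apply: contraNneq pk => /eqP; rewrite size_eq0 => /eqP p0.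
  by apply/eqP/qpath_eq => //; rewrite -pe /pend p0.
have [q [-> _ qe _]] := mut_pathT (qpath_survives pe).
by rewrite /= mul_trivrE qe (negbTE pe).
Qed.

Lemma star_startE c : e'_k * star c = star c.
Proof. by rewrite /Defs.star mulr_trivE eqxx. Qed.

Lemma star_endE c : star c * embed (pelt K (triv_path (j c))) = star c.
Proof. by rewrite /Defs.star mut_embed_triv mul_trivrE eqxx. Qed.

Lemma mut_embed_mul_star x c : embed x * star c = x@_(triv_path k) *: star c.
Proof. by rewrite -star_startE mulrA mut_embed_mul_source -pathalg_scaleAl. Qed.

Lemma triv_coef_star c v : (star c)@_(@triv_path Q' v) = 0.
Proof. by rewrite /Defs.star mcoeff_pelt; case: eqP. Qed.

Lemma triv_path_neq (v w : vert Q) : v != w -> triv_path v != triv_path w.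
Proof. by apply: contraNneq => /(congr1 (@pstart Q)) e; apply/eqP. Qed.

Lemma triv_coef_idem v w :
  (pelt K (triv_path v) : KQ)@_(triv_path w) = (v == w)%:R.
Proof.
rewrite mcoeff_pelt; have [->|vw] := eqVneq v w; first by rewrite eqxx.
by rewrite (negbTE (triv_path_neq vw)).
Qed.

Lemma star_source c : star c * e'_k = 0.
Proof.
by rewrite -star_endE -mulrA mut_embed_triv triv_idem (negbTE (j_neq c)) mulr0.
Qed.

Lemma star_mul_star c c' : star c * star c' = 0.
Proof.
rewrite -(star_endE c) -mulrA mut_embed_mul_star triv_coef_idem.
by rewrite (negbTE (j_neq c)) scale0r mulr0.
Qed.

(* every path of Q' is a path avoiding k, the trivial path at k, or a new arrow
   followed by a path avoiding k *)
Lemma mut_ext (V : lmodType K) (f g : {linear KQ' -> V}) :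
  (forall x, f (embed x) = g (embed x)) ->
  (forall c x, f (star c * embed x) = g (star c * embed x)) -> f =1 g.
Proof.
move=> fgE fgS; apply: pathalg_ext => q; have [qk|qk] := eqVneq (pstart q) k; last first.
  have [p e _] := mut_path_inv qk; have <- : embed (pelt K p) = pelt K q.
    by rewrite mut_embed_pelt e.
  exact: fgE.
case: q qk => -[i [|[b|c] s]] w; rewrite /pstart /= => ik; subst i.
- have -> : QPath w = @triv_path Q' k by exact: qpath_eq.
  by rewrite -mut_embed_triv.
- by case/andP: (w) => /eqP bk _; have := k_sink (val b); rewrite (bk : src (val b) = k) eqxx.
case/andP: (w) => _ cs; set q := @QPath Q' (j c, s) cs.
have [p e pk] := @mut_path_inv q (j_neq c).
have -> : pelt K (QPath w) = star c * embed (pelt K p).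
  rewrite mut_embed_pelt e /Defs.star pelt_mul pmul.unlock.
  have [//|r [-> rs _ ra]] := @pcat_ex Q' (@arrow_path Q' (inr c)) q.
  by rewrite /=; congr (pelt K _); exact: qpath_eq.
exact: fgS.
Qed.

Local Notation mut_res := (@mut_res K Q k C j).
Local Notation mut_coord := (@mut_coord K Q k C j).

Fact mut_res_linear : linear mut_res.
Proof. by rewrite mut_res.unlock; exact: mext_linear. Qed.
HB.instance Definition _ := GRing.isLinear.Build K KQ' KQ *:%R mut_res mut_res_linear.
Fact mut_coord_linear c : linear (mut_coord c).
Proof. by rewrite mut_coord.unlock; exact: mext_linear. Qed.
HB.instance Definition _ c :=
  GRing.isLinear.Build K KQ' KQ *:%R (mut_coord c) (mut_coord_linear c).

Lemma mut_resD z z' : mut_res (z + z') = mut_res z + mut_res z'.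
Proof. exact: linearD. Qed.
Lemma mut_coordD c z z' : mut_coord c (z + z') = mut_coord c z + mut_coord c z'.
Proof. exact: linearD. Qed.

Lemma mut_res_pelt q : mut_res (pelt K q) = res_path K q.
Proof. by rewrite mut_res.unlock [pelt]pelt.unlock mextU. Qed.
Lemma mut_coord_pelt c q : mut_coord c (pelt K q) = coord_path K c q.
Proof. by rewrite mut_coord.unlock [pelt]pelt.unlock mextU. Qed.

Local Notation ebar := (1 - e_k).

Lemma pelt_mul_ebar p : (pelt K p : KQ) * ebar = if pend p == k then 0 else pelt K p.
Proof. by rewrite mulrBr mulr1 mul_trivrE; case: eqP => _; rewrite ?subrr ?subr0. Qed.

(** Exactly the paths ending at [k] are lost: those of positive length under [embed], the trivial
    one under [mut_res]. *)
Lemma mut_res_embed x : mut_res (embed x) = x * ebar.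
Proof.
have lin1 : linear (fun x => mut_res (embed x)) by move=> c a b; rewrite !linearP.
have lin2 : linear (fun x : KQ => x * ebar).
  by move=> c a b; rewrite mulrDl -pathalg_scaleAl.
apply: (@pathalg_ext K Q _ (mklin lin1) (mklin lin2)) => p /=.
rewrite pelt_mul_ebar; have [pe|pe] := eqVneq (pend p) k.
  have [p0|p0] := eqVneq (plength p) 0%N.
    have -> : p = triv_path k.
      by apply: qpath_eq; rewrite -?pe /pend; rewrite (size0nil p0).
    by rewrite mut_embed_triv mut_res_pelt /res_path eqxx.
  by rewrite mut_embed_pelt mut_path_end // linear0.
have pS := qpath_survives pe.
have [q [e qs _ qa]] := mut_pathT pS; rewrite mut_embed_pelt e /= mut_res_pelt /res_path.
have /negbTE -> : pstart q != k.
  by apply: contraNneq pe; rewrite qs => /(sink_start k_sink) ->.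
by rewrite qa unmut_arrowsK // qs -surjective_pairing valK.
Qed.

Lemma mut_coord_embed c x : mut_coord c (embed x) = 0.
Proof.
have lin1 : linear (fun x => mut_coord c (embed x)) by move=> b x1 x2; rewrite !linearP.
apply: (@pathalg_ext K Q _ (mklin lin1) (hom0 _ _)) => p /=.
rewrite mut_embed_pelt; have [pS|/mut_pathN ->] := boolP (all (fun a => tgt a != k) (parrows p));
  last exact: linear0.
have [q [-> _ _ qa]] := mut_pathT pS; rewrite /= mut_coord_pelt /coord_path qa.
have := @mut_arrows_head _ pS c; case: (pmap _ _) => // a s h.
by case: eqP => // e; case: (h s); rewrite e.
Qed.

Lemma mut_res_star c x : mut_res (star c * embed x) = 0.
Proof.
have lin1 : linear (fun x => mut_res (star c * embed x)).
  by move=> b x1 x2; rewrite linearP mulrDr -pathalg_scaleAr linearP.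
apply: (@pathalg_ext K Q _ (mklin lin1) (hom0 _ _)) => p /=.
rewrite mut_embed_pelt; case: (mpath p) => [q|] /=; last by rewrite mulr0 linear0.
rewrite /Defs.star pelt_mul pmul.unlock; have [e|ne] := pselect (j c = pstart q); last first.
  by rewrite pcatN // linear0.
have [//|r [-> rs _ _]] := @pcat_ex Q' (@arrow_path Q' (inr c)) q.
by rewrite /= mut_res_pelt /res_path rs eqxx.
Qed.

Lemma mut_coord_star c c' x : mut_coord c (star c' * embed x) =
  if c == c' then pelt K (triv_path (j c)) * x * ebar else 0.
Proof.
have lin1 : linear (fun x => mut_coord c (star c' * embed x)).
  by move=> b x1 x2; rewrite linearP mulrDr -pathalg_scaleAr linearP.
have lin2 : linear (fun x : KQ => if c == c' then pelt K (triv_path (j c)) * x * ebar else 0).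
  move=> b x1 x2; case: eqP => _; last by rewrite scaler0 addr0.
  by rewrite [pelt K _ * _]mulrDr -pathalg_scaleAr [LHS]mulrDl -pathalg_scaleAl.
apply: (@pathalg_ext K Q _ (mklin lin1) (mklin lin2)) => p /=.
have [pe|pe] := eqVneq (pend p) k.
  rewrite -mulrA pelt_mul_ebar pe eqxx mulr0 if_same.
  have [p0|p0] := eqVneq (plength p) 0%N; last first.
    by rewrite mut_embed_pelt mut_path_end // mulr0 linear0.
  have -> : p = triv_path k.
    by apply: qpath_eq; rewrite -?pe /pend; rewrite (size0nil p0).
  by rewrite mut_embed_triv /Defs.star mul_trivrE /= (negbTE (j_neq c')) linear0.
rewrite -mulrA pelt_mul_ebar (negbTE pe) mulr_trivE mut_embed_pelt.
have pS := qpath_survives pe; have [q [-> qs _ qa]] := mut_pathT pS.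
rewrite /= /Defs.star pelt_mul pmul.unlock; have [e|ne] := pselect (j c' = pstart q); last first.
  rewrite pcatN // linear0; case: eqP => // cc; case: eqP => // jc.
  by case: ne; rewrite -cc qs.
have [//|r [-> rs _ ra]] := @pcat_ex Q' (@arrow_path Q' (inr c')) q.
rewrite /= mut_coord_pelt /coord_path ra /=.
have -> : (inr c' == inr c :> arr Q') = (c == c') by rewrite eq_sym.
case: eqP => // cc; rewrite cc e qs eqxx qa unmut_arrowsK //.
by rewrite -surjective_pairing valK.
Qed.

Lemma mut_triv_embed x : (embed x)@_(@triv_path Q' k) = x@_(triv_path k).
Proof.
have := congr1 (fun z => z@_(@triv_path Q' k)) (mut_embed_mul_source x).
by rewrite triv_coefM mcoeffZ mcoeff_pelt eqxx !mulr1.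
Qed.

Lemma mut_triv_star c z : (star c * z)@_(@triv_path Q' k) = 0.
Proof. by rewrite triv_coefM triv_coef_star mul0r. Qed.

Lemma ebar_mul x : x * ebar = x - x * e_k.
Proof. by rewrite mulrBr mulr1. Qed.

Lemma mut_decomp z :
  z = embed (mut_res z) + z@_(@triv_path Q' k) *: e'_k
      + \sum_c star c * embed (mut_coord c z).
Proof.
have lin : linear (fun z => embed (mut_res z) + z@_(@triv_path Q' k) *: e'_k
      + \sum_c star c * embed (mut_coord c z)).
  move=> b x y.
  have linA : embed (mut_res (b *: x + y)) = b *: embed (mut_res x) + embed (mut_res y).
    by rewrite !linearP.
  have linC c : star c * embed (mut_coord c (b *: x + y)) =
      b *: (star c * embed (mut_coord c x)) + star c * embed (mut_coord c y).
    by rewrite linearP linearP mulrDr -pathalg_scaleAr.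
  have linS : \sum_c star c * embed (mut_coord c (b *: x + y)) =
      b *: (\sum_c star c * embed (mut_coord c x)) + \sum_c star c * embed (mut_coord c y).
    by rewrite scaler_sumr -big_split; apply: eq_bigr => c _; exact: linC.
  have linB : (b *: x + y)@_(@triv_path Q' k) *: e'_k =
      b *: (x@_(@triv_path Q' k) *: e'_k) + y@_(@triv_path Q' k) *: e'_k.
    by rewrite mcoeffD mcoeffZ scalerDl -scalerA.
  apply: (etrans (congr2 +%R (congr2 +%R linA linB) linS)); rewrite !scalerDr.
  by rewrite [X in X + _]addrACA [LHS]addrACA.
apply: (@mut_ext _ idfun (mklin lin)) => [x|c x] /=.
  rewrite big1; last by move=> c _; rewrite mut_coord_embed linear0 mulr0.
  rewrite addr0 mut_res_embed mut_triv_embed ebar_mul linearB /= mut_embedM.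
  by rewrite mut_embed_triv mut_embed_mul_source subrK.
rewrite mut_res_star linear0 mut_triv_star scale0r !add0r (bigD1 c) //= big1; last first.
  by move=> c' /negbTE cc; rewrite mut_coord_star cc linear0 mulr0.
rewrite mut_coord_star eqxx addr0 ebar_mul linearB mulrBr /= !mut_embedM.
have starE z' : star c * (embed (pelt K (triv_path (j c))) * z') = star c * z'.
  by rewrite mulrA star_endE.
by rewrite -mulrA starE starE mut_embed_triv mut_embed_mul_source -pathalg_scaleAr
  star_source scaler0 subr0.
Qed.

(** At a sink [e_k y (1 - e_k) = 0], so right multiplication by [1 - e_k] respects products. *)
Lemma mulr_ebarM x y : x * y * ebar = x * ebar * (y * ebar).
Proof.
have ke : e_k * (y * ebar) = 0.
  by rewrite mulrA mul_triv_sink // -pathalg_scaleAl mulrBr mulr1 triv_idem eqxx subrr scaler0.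
by rewrite -[RHS]mulrA [ebar * _]mulrBl mul1r ke subr0 mulrA.
Qed.

Lemma mut_resM z z' : mut_res (z * z') = mut_res z * mut_res z'.
Proof.
have lin1 w : linear (fun z => mut_res (z * w)).
  by move=> c a b; rewrite mulrDl -pathalg_scaleAl linearP.
have lin2 w : linear (fun z => mut_res (w * z)).
  by move=> c a b; rewrite mulrDr -pathalg_scaleAr linearP.
have lin3 w : linear (fun z => mut_res z * w).
  by move=> c a b; rewrite linearP mulrDl -pathalg_scaleAl.
have lin4 w : linear (fun z => w * mut_res z).
  by move=> c a b; rewrite linearP mulrDr -pathalg_scaleAr.
apply: (@mut_ext _ (mklin (lin1 z')) (mklin (lin3 _))) => [x|c x] /=;
  apply: (@mut_ext _ (mklin (lin2 _)) (mklin (lin4 _))) => [y|c' y] /=.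
- by rewrite -mut_embedM !mut_res_embed mulr_ebarM.
- rewrite mulrA mut_embed_mul_star -pathalg_scaleAl linearZ /=.
  by rewrite mut_res_star scaler0 mulr0.
- by rewrite -mulrA -mut_embedM !mut_res_star mul0r.
- rewrite mulrA -[star c * _ * _]mulrA mut_embed_mul_star -pathalg_scaleAr star_mul_star.
  by rewrite scaler0 mul0r linear0 mut_res_star mul0r.
Qed.

(** Multiplication of triangular matrices: the diagonal entries of [z] are its coefficient at the
    trivial path of [k] and [mut_res z], the off-diagonal entry is the column of its coordinates. *)
Lemma mut_coordM c z z' : mut_coord c (z * z') =
  z@_(@triv_path Q' k) *: mut_coord c z' + mut_coord c z * mut_res z'.
Proof.
have lin1 w : linear (fun z => mut_coord c (z * w)).
  by move=> b x y; rewrite mulrDl -pathalg_scaleAl linearP.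
have lin2 w : linear (fun z => mut_coord c (w * z)).
  by move=> b x y; rewrite mulrDr -pathalg_scaleAr linearP.
have lin3 w : linear (fun z => z@_(@triv_path Q' k) *: mut_coord c w + mut_coord c z * mut_res w).
  move=> b x y; rewrite linearP mulrDl -pathalg_scaleAl mcoeffD mcoeffZ scalerDl -scalerA.
  by rewrite [in RHS]scalerDr [LHS]addrACA.
have lin4 w : linear (fun z => w@_(@triv_path Q' k) *: mut_coord c z + mut_coord c w * mut_res z).
  move=> b x y; rewrite (mut_coord_linear c b x y) (mut_res_linear b x y).
  move: (mut_coord c x) (mut_coord c y) (mut_coord c w) (mut_res x) (mut_res y) (w@_ _).
  move=> cx cy cw rx ry wk; rewrite mulrDr -pathalg_scaleAr !scalerDr !scalerA.
  by rewrite [b * _]mulrC [LHS]addrACA.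
apply: (@mut_ext _ (mklin (lin1 z')) (mklin (lin3 _))) => [x|c1 x] /=;
  apply: (@mut_ext _ (mklin (lin2 _)) (mklin (lin4 _))) => [y|c' y] /=.
- by rewrite -mut_embedM !mut_coord_embed mul0r scaler0 addr0.
- rewrite mulrA mut_embed_mul_star -pathalg_scaleAl linearZ /=.
  by rewrite mut_triv_embed mut_coord_embed mul0r addr0.
- rewrite -mulrA -mut_embedM !mut_coord_star mut_triv_star scale0r add0r.
  case: eqP => // _; last by rewrite mul0r.
  by rewrite mut_res_embed -[in RHS](mulrA _ x) -[RHS]mulrA -mulr_ebarM !mulrA.
- rewrite mulrA -[star c1 * _ * _]mulrA mut_embed_mul_star -pathalg_scaleAr star_mul_star.
  by rewrite scaler0 mul0r linear0 mut_triv_star scale0r mut_res_star mulr0 addr0.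
Qed.

End MutatedPaths.

(** * The endomorphism algebra *)

Section BoolSelection.
Variables (A : pzRingType) (X Y : lmodType A) (b : bool).
Local Notation S := (if b then X else Y : lmodType A).

(** Projections and injections for a module given by a conditional, such as a summand of [T_k]. The
    dependent matches make them compute on each boolean without transports. *)
Definition sel_fst : {linear S -> X} :=
  if b as b' return {linear (if b' then X else Y : lmodType A) -> X}
  then (idfun : {linear X -> X}) else hom0 Y X.
Definition sel_snd : {linear S -> Y} :=
  if b as b' return {linear (if b' then X else Y : lmodType A) -> Y}
  then hom0 X Y else (idfun : {linear Y -> Y}).
Definition in_fst : {linear X -> S} :=
  if b as b' return {linear X -> (if b' then X else Y : lmodType A)}
  then (idfun : {linear X -> X}) else hom0 X Y.
Definition in_snd : {linear Y -> S} :=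
  if b as b' return {linear Y -> (if b' then X else Y : lmodType A)}
  then hom0 Y X else (idfun : {linear Y -> Y}).
End BoolSelection.
Arguments sel_fst {A} X Y b.
Arguments sel_snd {A} X Y b.
Arguments in_fst {A} X Y b.
Arguments in_snd {A} X Y b.

Section BoolSelectionTheory.
Variables (A : pzRingType) (X Y : lmodType A).
Lemma sel_fstK b x : sel_fst X Y b (in_fst X Y b x) = if b then x else 0.
Proof. by case: b. Qed.
Lemma sel_sndK b y : sel_snd X Y b (in_snd X Y b y) = if b then 0 else y.
Proof. by case: b. Qed.
Lemma sel_fst_snd b y : sel_fst X Y b (in_snd X Y b y) = 0.
Proof. by case: b. Qed.
Lemma sel_snd_fst b x : sel_snd X Y b (in_fst X Y b x) = 0.
Proof. by case: b. Qed.
Lemma sel_snd0 (b : bool) y : b -> sel_snd X Y b y = 0.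
Proof. by case: b y. Qed.
Lemma in_fst0 (b : bool) x : ~~ b -> in_fst X Y b x = 0.
Proof. by case: b. Qed.
Lemma in_snd0 (b : bool) y : b -> in_snd X Y b y = 0.
Proof. by case: b. Qed.
Lemma sel_decomp b (x : if b then X else Y) :
  x = in_fst X Y b (sel_fst X Y b x) + in_snd X Y b (sel_snd X Y b x).
Proof. by case: b x => x /=; rewrite ?addr0 ?add0r. Qed.
End BoolSelectionTheory.

Section PathProjection.
Variables (K : fieldType) (Q : quiver) (R : set (pathalg K Q)).
Local Notation L := (quotalg R).

Lemma qpi0 : qpi R 0 = 0. Proof. exact: linear0. Qed.

Lemma qpiD x y : qpi R (x + y) = qpi R x + qpi R y. Proof. exact: linearD. Qed.

Lemma qpiM x y : qpi R (x * y) = qpi R x * qpi R y. Proof. exact: rmorphM. Qed.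

Lemma qpi_eq0 x : qpi R x = 0 <-> ideal R x.
Proof. by rewrite -{1}qpi0 -[in X in _ <-> X](subr0 x); exact: qpi_eq. Qed.

Definition pmod_of (v : vert Q) (l : L) : Pmod R v := sval (cid (Pval_ex v l)).

Lemma Pval_pmod_of v l : Pval (pmod_of v l) = idem R v * l.
Proof. exact: (svalP (cid (Pval_ex v l))). Qed.

Lemma pmod_ofD v l l' : pmod_of v (l + l') = pmod_of v l + pmod_of v l'.
Proof. by apply: Pval_inj; rewrite PvalD !Pval_pmod_of mulrDr. Qed.

Lemma pmod_ofM v l l' : pmod_of v (l * l') = (l' : L^c) *: pmod_of v l.
Proof. by apply: Pval_inj; rewrite PvalZ !Pval_pmod_of mulrA. Qed.

Lemma Pval0 v : Pval (0 : Pmod R v) = 0.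
Proof. exact: (linear0 (val : Pmod R v -> L)). Qed.

Lemma idemMv v : idem R v * idem R v = idem R v.
Proof. by rewrite /idem -rmorphM triv_idem eqxx. Qed.

Lemma idemMw v w : v != w -> idem R v * idem R w = 0.
Proof. by move=> vw; rewrite /idem -rmorphM triv_idem (negbTE vw); exact: linear0. Qed.

Lemma Pval_idem v (x : Pmod R v) : idem R v * Pval x = Pval x.
Proof. by have [y ->] := PvalE x; rewrite mulrA idemMv. Qed.

End PathProjection.

(** * The action of the new path algebra on the tilting module *)

Section EndomorphismAlgebra.
Variables (K : fieldType) (Q : quiver) (R : set (pathalg K Q)) (k : vert Q).
Local Notation L := (quotalg R).
Hypotheses (R_relation : forall r, R r -> is_relation r) (k_sink : is_sink k).
Variables (B C : finType) (i : B -> vert Q) (j : C -> vert Q).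
Hypothesis j_neq : forall c, j c != k.
Variables (n : nat) (a : C -> B -> pathalg K Q).
Hypothesis a_paths :
  forall c b p, p \in msupp (a c b) -> pstart p = j c /\ pend p = i b.
Hypotheses (i_neq : (1 < n)%N -> forall b, i b != k)
           (i_eq : ~~ (1 < n)%N -> forall b, i b = k).
Variables (tau : lmodType L^c) (beta : {linear dsum (fun c => Pmod R (j c)) -> tau}).
Hypotheses (beta_surj : forall x, exists y, x = beta y)
  (beta_ker : forall y, beta y = 0 <-> exists x : dsum (fun b => Pmod R (i b)),
     forall c, Pval (y c) = \sum_b qpi R (a c b) * Pval (x b)).
Hypotheses (tau_hom0 : forall h : tau -> L, (forall x y, h (x + y) = h x + h y) ->
     (forall (l : L) x, h ((l : L^c) *: x) = h x * l) -> forall x, h x = 0)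
  (tau_scalar : forall g : {linear tau -> tau}, exists c : K, forall x, g x = scal R c *: x)
  (tau_nontriv : ~ trivial_mod tau).

Local Notation Q' := (mut_quiver k j).
Local Notation KQ := (pathalg K Q).
Local Notation KQ' := (pathalg K Q').
Local Notation embed := (@mut_emb K Q k C j).
Local Notation res := (@mut_res K Q k C j).
Local Notation coord := (@mut_coord K Q k C j).
Local Notation star c := (@star Q k C j K c).
Local Notation kap z := (z@_(@triv_path Q' k)).
Local Notation e_k := (pelt K (triv_path k) : KQ).
Local Notation e'_k := (pelt K (@triv_path Q' k) : KQ').
Local Notation R' := (mut_relations k j n R a).
Local Notation summand := (fun v : vert Q => if v == k then tau else Pmod R v : lmodType L^c).
Local Notation T := (dsum summand).
Implicit Types (t : T) (l : L) (z : KQ').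

Definition rho b : KQ' := \sum_c star c * embed (a c b).

Lemma mut_relationsP r : R' r <->
  (exists r0, [/\ R r0, ~ ends_at k r0 & r = embed r0]) \/
  ((1 < n)%N /\ exists b, r = rho b).
Proof.
have rhoE b : \sum_c star c * mut_embed k j (a c b) = rho b.
  by apply: eq_bigr => c _; rewrite mut_embE.
split=> [[[r0 [Rr0 nk] <-]|[n1 [b ->]]]|[[r0 [Rr0 nk ->]]|[n1 [b ->]]]].
- by left; exists r0; rewrite mut_embE.
- by right; split=> //; exists b; rewrite rhoE.
- by left; exists r0 => //; rewrite mut_embE.
- by right; split=> //; exists b; rewrite rhoE.
Qed.

Lemma a_start c b : pelt K (triv_path (j c)) * a c b = a c b.
Proof. by apply: mul_triv_start => p /a_paths[]. Qed.

Lemma a_end c b : a c b * pelt K (triv_path (i b)) = a c b.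
Proof. by apply: mul_triv_end => p /a_paths[]. Qed.

Lemma mut_emb_ends r : (forall p, p \in msupp r -> pend p = k /\ plength p != 0%N) ->
  embed r = 0.
Proof.
move=> rk; rewrite (msupp_sum r) linear_sum big_seq big1 // => p /rk[pk p0].
by rewrite linearZ /= mut_embed_pelt mut_path_end // scaler0.
Qed.

Lemma mut_emb_relation_ends r : R r -> ends_at k r -> embed r = 0.
Proof.
move=> /R_relation[v [w rP]] rk; apply: mut_emb_ends => p pr; split; first exact: rk.
by have [_ _] := rP p pr; case: (plength p).
Qed.

(** For [n > 1] these elements are generators. Otherwise all [i b] equal [k], the entries consist of
    nontrivial paths ending at [k], and the elements are zero. *)
Lemma rho_ideal b : ideal R' (rho b).
Proof.
have [n1|n1] := boolP (1 < n)%N.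
  by apply: ideal_gen; apply/mut_relationsP; right; split=> //; exists b.
have -> : rho b = 0.
  apply: big1 => c _; rewrite mut_emb_ends ?mulr0 // => p /a_paths[ps pe].
  split; first by rewrite pe i_eq.
  apply: contraNneq (j_neq c) => p0; rewrite -ps -(i_eq n1 b) -pe /pend.
  by rewrite (size0nil p0).
by have [] := ideal_ideal R'.
Qed.

(** Relations ending at [k] are sent to zero, all others to new generators. *)
Lemma mut_emb_ideal x : ideal R x -> ideal R' (embed x).
Proof.
have [I0 ID IM] := ideal_ideal R'.
apply: (@ideal_sub K Q R (fun x => ideal R' (embed x))).
  split=> [|x1 x2 I1 I2|x1 x2 I2]; first by rewrite linear0.
    by rewrite linearD; exact: ID.
  by rewrite !mut_embedM; exact: IM.
move=> r Rr; have [rk|rk] := pselect (ends_at k r).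
  by rewrite mut_emb_relation_ends.
by apply: ideal_gen; apply/mut_relationsP; left; exists r.
Qed.

Lemma res_relation r : R' r -> ideal R (res r).
Proof.
have [I0 _ IM] := ideal_ideal R.
move=> /mut_relationsP[[r0 [Rr0 _ ->]]|[_ [b ->]]].
  by rewrite mut_res_embed //; case: (IM (1 - e_k) r0 (ideal_gen Rr0)).
by rewrite linear_sum big1 // => c _; exact: mut_res_star.
Qed.

Lemma kap_relation r : R' r -> kap r = 0.
Proof.
move=> /mut_relationsP[[r0 [Rr0 _ ->]]|[_ [b ->]]].
  by rewrite mut_triv_embed // relation_triv_coef //; exact: R_relation.
by rewrite /rho raddf_sum big1 // => c _; exact: mut_triv_star.
Qed.

(** The coordinates of a relation lie in the column space of the matrix [a]. The clause on vanishing
    of [l] records which columns occur; it serves the minimality proof. *)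
Lemma coord_relation r : R' r ->
  exists l : B -> L, (forall b, rho b <> r -> l b = 0) /\
    forall c, qpi R (coord c r) = \sum_b qpi R (a c b) * (idem R (i b) * l b).
Proof.
move=> /mut_relationsP[[r0 [Rr0 _ ->]]|[n1 [b ->]]].
  exists (fun _ => 0); split=> // c; rewrite mut_coord_embed // big1 => [|b _].
    exact: (linear0 (qpi R)).
  by rewrite !mulr0.
exists (fun b' => if b' == b then 1 else 0); split=> [b'|c]; first by case: eqP => // ->.
rewrite /rho linear_sum (bigD1 c) //= big1; last first.
  by move=> c' /negbTE cc; rewrite mut_coord_star // eq_sym cc.
rewrite mut_coord_star // eqxx addr0 a_start ebar_mul -{2}(a_end c b) -mulrA triv_idem.
rewrite (negbTE (i_neq n1 b)) mulr0 subr0 (bigD1 b) //= big1; last first.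
  by move=> b' /negbTE ->; rewrite !mulr0.
by rewrite eqxx addr0 mulr1 /idem -rmorphM a_end.
Qed.

(** Coordinates on [T], viewed as [tau] plus [(1 - e_k) L]: all summands [P_v] with [v] different
    from [k] are collected in a single element of [L]. *)
Definition tau_part t : tau := sel_fst tau (Pmod R k) (k == k) (t k).
Definition proj_part t : L := \sum_v Pval (sel_snd tau (Pmod R v) (v == k) (t v)).
Definition in_tau (x : tau) : T := fun v =>
  in_fst tau (Pmod R v) (v == k) x.
Definition in_proj (l : L) : T := fun v =>
  in_snd tau (Pmod R v) (v == k) (pmod_of v l).

Lemma tau_part_linear : linear tau_part.
Proof. by move=> c x y; rewrite /tau_part -linearP. Qed.
Lemma proj_partD x y : proj_part (x + y) = proj_part x + proj_part y.
Proof. by rewrite /proj_part -big_split; apply: eq_bigr => v _;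
  exact: (etrans (congr1 (@Pval _ _ _ _) (linearD _ _ _)) (PvalD _ _)). Qed.
Lemma proj_partZ l x : proj_part ((l : L^c) *: x) = proj_part x * l.
Proof. by rewrite /proj_part mulr_suml; apply: eq_bigr => v _;
  exact: (etrans (congr1 (@Pval _ _ _ _) (linearZ_LR _ _ _)) (PvalZ _ _)). Qed.
Lemma in_tau_linear : linear in_tau.
Proof. by move=> c x y; apply: functional_extensionality_dep => v; exact: linearP. Qed.
Lemma in_projM l l' : in_proj (l * l') = (l' : L^c) *: in_proj l.
Proof.
apply: functional_extensionality_dep => v.
by rewrite /in_proj pmod_ofM; exact: linearZ_LR.
Qed.

Lemma tau_part_in_tau x : tau_part (in_tau x) = x.
Proof. by rewrite /tau_part /in_tau sel_fstK eqxx. Qed.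
Lemma tau_part_in_proj l : tau_part (in_proj l) = 0.
Proof. exact: sel_fst_snd. Qed.
Lemma proj_part_in_tau x : proj_part (in_tau x) = 0.
Proof. by apply: big1 => v _; rewrite sel_snd_fst Pval0. Qed.
Lemma proj_part_in_proj l : proj_part (in_proj l) = (1 - idem R k) * l.
Proof.
rewrite /proj_part mulrBl mul1r -{2}(mul1r l) -(sum_idem R) mulr_suml.
rewrite [in RHS](bigD1 k) //= addrAC subrr add0r (bigD1 k) //=.
rewrite sel_sndK eqxx Pval0 add0r; apply: eq_bigr => v /negbTE vk.
by rewrite sel_sndK vk Pval_pmod_of.
Qed.

Lemma proj_part_idem t : (1 - idem R k) * proj_part t = proj_part t.
Proof.
rewrite mulrBl mul1r /proj_part mulr_sumr [X in _ - X]big1 ?subr0 // => v _.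
have [vk|/eqP vk] := pselect (v = k); first by rewrite sel_snd0 ?Pval0 ?mulr0 // vk.
by rewrite -Pval_idem mulrA idemMw ?mul0r // eq_sym.
Qed.

Lemma T_decomp t : t = in_tau (tau_part t) + in_proj (proj_part t).
Proof.
apply: functional_extensionality_dep => v; rewrite [LHS]sel_decomp.
congr (_ + _).
  rewrite /in_tau; have [vk|/eqP vk] := pselect (v = k); last by rewrite !in_fst0.
  by subst v.
rewrite /in_proj; have [vk|/eqP vk] := pselect (v = k); first by rewrite !in_snd0 // vk.
congr (in_snd _ _ _ _); apply: Pval_inj; rewrite Pval_pmod_of mulr_sumr (bigD1 v) //=.
rewrite Pval_idem big1 ?addr0 // => w wv.
by rewrite -Pval_idem mulrA idemMw ?mul0r // eq_sym.
Qed.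

Lemma T_ext (t t' : T) : tau_part t = tau_part t' -> proj_part t = proj_part t' -> t = t'.
Proof. by move=> e1 e2; rewrite (T_decomp t) e1 e2 -T_decomp. Qed.

Lemma res_start z : (1 - e_k) * res z = res z.
Proof.
have lin1 : linear (fun z => (1 - e_k) * res z).
  move=> c x y; rewrite (mut_res_linear c x y).
  by move: (res x) (res y) => rx ry; rewrite mulrDr -pathalg_scaleAr.
apply: (@mut_ext K Q k C j k_sink j_neq _ (mklin lin1) res) => [x|c x] /=.
  rewrite mut_res_embed // mulrBl mul1r mulrA mul_triv_sink // -pathalg_scaleAl.
  by rewrite [e_k * _]mulrBr mulr1 triv_idem eqxx subrr scaler0 subr0.
by rewrite mut_res_star mulr0.
Qed.

Lemma res_end z : res z * (1 - e_k) = res z.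
Proof.
have lin1 : linear (fun z => res z * (1 - e_k)).
  move=> c x y; rewrite (mut_res_linear c x y).
  by move: (res x) (res y) => rx ry; rewrite mulrDl -pathalg_scaleAl.
apply: (@mut_ext K Q k C j k_sink j_neq _ (mklin lin1) res) => [x|c x] /=.
  by rewrite mut_res_embed // -[LHS]mulrA [X in x * X]mulrBr mulr1 mulrBl mul1r
    triv_idem eqxx subrr subr0.
by rewrite mut_res_star mul0r.
Qed.

Lemma coord_end c z : coord c z * (1 - e_k) = coord c z.
Proof.
have lin1 : linear (fun z => coord c z * (1 - e_k)).
  move=> b x y; rewrite (mut_coord_linear c b x y).
  by move: (coord c x) (coord c y) => rx ry; rewrite mulrDl -pathalg_scaleAl.
apply: (@mut_ext K Q k C j k_sink j_neq _ (mklin lin1) (coord c)) => [x|c' x] /=.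
  by rewrite mut_coord_embed mul0r.
rewrite mut_coord_star //; case: eqP => _; last by rewrite mul0r.
by rewrite -[LHS]mulrA [X in _ * X]mulrBr mulr1 mulrBl mul1r
    triv_idem eqxx subrr subr0.
Qed.

Lemma coord_start c z : pelt K (triv_path (j c)) * coord c z = coord c z.
Proof.
have lin1 : linear (fun z => pelt K (triv_path (j c)) * coord c z).
  move=> b x y; rewrite (mut_coord_linear c b x y).
  by move: (coord c x) (coord c y) => rx ry; rewrite mulrDr -pathalg_scaleAr.
apply: (@mut_ext K Q k C j k_sink j_neq _ (mklin lin1) (coord c)) => [x|c' x] /=.
  by rewrite mut_coord_embed mulr0.
rewrite mut_coord_star //; case: eqP => _; last by rewrite mulr0.
by rewrite !mulrA triv_idem eqxx.
Qed.

Definition coord_vec z l : dsum (fun c => Pmod R (j c)) :=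
  fun c => pmod_of (j c) (qpi R (coord c z) * l).

Lemma coord_vecD z l l' : coord_vec z (l + l') = coord_vec z l + coord_vec z l'.
Proof.
apply: functional_extensionality_dep => c; rewrite /coord_vec mulrDr.
exact: pmod_ofD.
Qed.
Lemma coord_vecZ z l l' : coord_vec z (l * l') = (l' : L^c) *: coord_vec z l.
Proof.
apply: functional_extensionality_dep => c; rewrite /coord_vec mulrA.
exact: pmod_ofM.
Qed.
Lemma scal_pmod (v : vert Q) (c : K) l : pmod_of v (c *: l) = scal R c *: pmod_of v l.
Proof. by rewrite -pmod_ofM /scal -quotalg_scaleAr mulr1. Qed.
Lemma coord_vec_linear l (c : K) z z' :
  coord_vec (c *: z + z') l = scal R c *: coord_vec z l + coord_vec z' l.
Proof.
apply: functional_extensionality_dep => b; rewrite /coord_vec.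
have -> : qpi R (coord b (c *: z + z')) * l =
    c *: (qpi R (coord b z) * l) + qpi R (coord b z') * l.
  rewrite (mut_coord_linear b c z z') (qpi_linear R c (coord b z) (coord b z')).
  by rewrite mulrDl quotalg_scaleAl.
rewrite pmod_ofD scal_pmod; exact: erefl.
Qed.
Lemma coord_vecM z z' l : coord_vec (z * z') l =
  scal R (kap z) *: coord_vec z' l + coord_vec z (qpi R (res z') * l).
Proof.
apply: functional_extensionality_dep => b; rewrite /coord_vec mut_coordM //.
have -> : qpi R (kap z *: coord b z' + coord b z * res z') * l =
    kap z *: (qpi R (coord b z') * l) + qpi R (coord b z) * (qpi R (res z') * l).
  rewrite (qpi_linear R _ (coord b z')) mulrDl quotalg_scaleAl mulrA.
  by rewrite [qpi R (coord b z * res z')]rmorphM.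
rewrite pmod_ofD scal_pmod; exact: erefl.
Qed.

(** The triangular matrix of [z], with its coordinate column pushed to [tau] by [beta], applied to
    the pair of [tau_part t] and [proj_part t]. *)
Definition act_tau z t : tau :=
  scal R (kap z) *: tau_part t + beta (coord_vec z (proj_part t)).
Definition act_fun z t : T := in_tau (act_tau z t) + in_proj (qpi R (res z) * proj_part t).

Lemma tau_partD x y : tau_part (x + y) = tau_part x + tau_part y.
Proof. exact: (linearD (mklin tau_part_linear)). Qed.
Lemma tau_partZ (l : L) x : tau_part ((l : L^c) *: x) = (l : L^c) *: tau_part x.
Proof. exact: (linearZ_LR (mklin tau_part_linear)). Qed.

Lemma tau_part0 : tau_part 0 = 0.
Proof. exact: (linear0 (mklin tau_part_linear)). Qed.
Lemma proj_part0 : proj_part 0 = 0.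
Proof. by have := proj_partZ 0 0; rewrite scale0r mulr0. Qed.

Lemma tau_part_act z t : tau_part (act_fun z t) = act_tau z t.
Proof. by rewrite tau_partD tau_part_in_tau tau_part_in_proj addr0. Qed.

Lemma proj_part_act z t : proj_part (act_fun z t) = qpi R (res z) * proj_part t.
Proof.
rewrite proj_partD proj_part_in_tau add0r proj_part_in_proj mulrA; congr (_ * _).
transitivity (qpi R ((1 - e_k) * res z)); last by rewrite res_start.
by rewrite [RHS]rmorphM rmorphB rmorph1.
Qed.

Fact act_linear z : linear (act_fun z).
Proof.
move=> l x y; apply: T_ext.
  rewrite tau_part_act tau_partD tau_partZ !tau_part_act /act_tau.
  rewrite proj_partD proj_partZ coord_vecD coord_vecZ (linearD beta) (linearZ_LR beta).
  rewrite tau_partD tau_partZ !scalerDr.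
  rewrite [LHS]addrACA; congr (_ + _ + _); by rewrite !scalerA scal_central.
by rewrite [RHS]proj_partD proj_partZ !proj_part_act proj_partD proj_partZ mulrDr mulrA.
Qed.

Definition act z : End T := mklin (act_linear z).

Lemma End_ext (g h : End T) : (forall t, g t = h t) -> g = h.
Proof. by move=> gh; exact: linear_eq. Qed.

Lemma act_is_linear : linear act.
Proof.
move=> c z z'; apply: End_ext => t.
change (act_fun (c *: z + z') t = scal R c *: act_fun z t + act_fun z' t).
apply: T_ext.
  rewrite [RHS]tau_partD tau_partZ !tau_part_act /act_tau coord_vec_linear.
  rewrite (linearP beta) mcoeffD mcoeffZ scalerDr [RHS]addrACA; congr (_ + _).
  by rewrite scalerA scalM -scalerDl /scal -scalerDl.
rewrite [RHS]proj_partD proj_partZ !proj_part_act (mut_res_linear c z z') (qpi_linear R c _ _).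
rewrite mulrDl -quotalg_scaleAl; congr (_ + _).
by rewrite /scal -quotalg_scaleAr mulr1.
Qed.

Lemma actD z z' : act (z + z') = act z + act z'.
Proof. exact: (linearD (mklin act_is_linear)). Qed.
Lemma actB z z' : act (z - z') = act z - act z'.
Proof. exact: (linearB (mklin act_is_linear)). Qed.

Lemma act1 : act 1 = 1.
Proof.
apply: End_ext => t; change (act_fun 1 t = t).
have one : (1 : KQ') = embed 1 by rewrite mut_embed1.
apply: T_ext.
  rewrite tau_part_act /act_tau.
  have -> : kap (1 : KQ') = 1.
    rewrite one mut_triv_embed // /GRing.one /= /pathalg_one raddf_sum (bigD1 k) //=.
    rewrite mcoeff_pelt eqxx big1 ?addr0 // => v vk.
    by rewrite mcoeff_pelt (negbTE (triv_path_neq vk)).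
  rewrite /scal !scale1r; have -> : coord_vec 1 (proj_part t) = 0.
    apply: functional_extensionality_dep => c; rewrite /coord_vec one mut_coord_embed.
    apply: Pval_inj; rewrite Pval_pmod_of (linear0 (qpi R)) mul0r mulr0.
    exact: esym (Pval0 _ _).
  by rewrite linear0 addr0.
rewrite proj_part_act one mut_res_embed // mul1r rmorphB rmorph1.
exact: proj_part_idem.
Qed.

Lemma actM z z' : act (z * z') = act z * act z'.
Proof.
apply: End_ext => t; change (act_fun (z * z') t = act_fun z (act_fun z' t)).
apply: T_ext.
  rewrite !tau_part_act /act_tau tau_part_act proj_part_act triv_coefM coord_vecM.
  rewrite (linearD beta) (linearZ_LR beta) /act_tau scalerDr -addrA; congr (_ + _).
  by rewrite scalerA scalM.
by rewrite !proj_part_act mut_resM // rmorphM mulrA.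
Qed.

Lemma act_relation r : R' r -> act r = 0.
Proof.
move=> rR; apply: End_ext => t; change (act_fun r t = 0).
apply: T_ext.
  rewrite tau_part_act /act_tau kap_relation // /scal !scale0r add0r.
  rewrite tau_part0; apply/beta_ker.
  have [l [_ lP]] := coord_relation rR.
  (* The coordinates of a relation are a combination of the columns of [a], and these generate the
     kernel of [beta]. *)
  exists (fun b => pmod_of (i b) (l b * proj_part t)) => c.
  rewrite Pval_pmod_of lP mulr_suml mulr_sumr; apply: eq_bigr => b _.
  rewrite Pval_pmod_of !mulrA; congr (_ * _ * _ * _).
  by rewrite /idem -rmorphM a_start.
rewrite proj_part0 proj_part_act; suff -> : qpi R (res r) = 0 by rewrite mul0r.
by apply/qpi_eq0; exact: res_relation rR.
Qed.

Lemma act_ideal z : ideal R' z -> act z = 0.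
Proof.
apply: (@ideal_sub K Q' R' (fun z => act z = 0)); last exact: act_relation.
split=> [|x y x0 y0|x y y0]; first exact: (linear0 (mklin act_is_linear)).
  by rewrite actD x0 y0 addr0.
by split; rewrite actM y0 ?mulr0 ?mul0r.
Qed.

(** Testing on [tau] kills the coefficient at [k]. Testing on [1 - e_k] puts [res z] into the old
    ideal and the coordinates, modulo that ideal, into the column space of [a]. The decomposition of
    [z] then exhibits it in the new ideal. *)
Lemma act_inj z : act z = 0 -> ideal R' z.
Proof.
move=> z0; have zt t : act_fun z t = 0 by exact: (congr1 (fun g : End T => g t) z0).
have kap0 : kap z = 0.
  apply/eqP/negPn/negP => kz; apply: tau_nontriv => x.
  have := congr1 tau_part (zt (in_tau x)); rewrite tau_part_act /act_tau tau_part0.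
  rewrite tau_part_in_tau proj_part_in_tau.
  have -> : coord_vec z 0 = 0 by have := coord_vecZ z 0 0; rewrite scale0r mulr0.
  rewrite linear0 addr0 => kx.
  have : scal R (kap z)^-1 *: (scal R (kap z) *: x) = 0 by rewrite kx scaler0.
  by rewrite scalerA scalM mulVf // /scal !scale1r.
have res0 : ideal R (res z).
  have := congr1 proj_part (zt (in_proj 1)); rewrite proj_part_act proj_part0.
  rewrite proj_part_in_proj mulr1.
  have -> : qpi R (res z) * (1 - idem R k) = qpi R (res z * (1 - e_k)).
    by rewrite rmorphM rmorphB rmorph1.
  by rewrite res_end => /qpi_eq0.
have [x xP] : exists x : dsum (fun b => Pmod R (i b)),
    forall c, qpi R (coord c z) = \sum_b qpi R (a c b) * Pval (x b).
  have := congr1 tau_part (zt (in_proj 1)); rewrite tau_part_act /act_tau tau_part0.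
  rewrite kap0 /scal !scale0r add0r proj_part_in_proj mulr1 => /beta_ker[x xP].
  exists x => c; rewrite -xP Pval_pmod_of.
  transitivity (qpi R (pelt K (triv_path (j c)) * (coord c z * (1 - e_k)))).
    by rewrite coord_end coord_start.
  by rewrite rmorphM rmorphM rmorphB rmorph1.
have [I0 ID IM] := ideal_ideal R'.
have Isum (U : finType) (F : U -> KQ') : (forall u, ideal R' (F u)) -> ideal R' (\sum_u F u).
  by move=> IF; elim/big_rec: _ => [|u y _ Iy]; [exact: I0 | exact: ID].
rewrite [z](mut_decomp k_sink j_neq) kap0 scale0r addr0; refine (ID _ _ _ _).
  exact: mut_emb_ideal.
have [w wP] : exists w : B -> KQ, forall b, Pval (x b) = qpi R (w b).
  by have [w wP] := choice (fun b => qpi_surj (Pval (x b))); exists w.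
(* The part of the coordinate that vanishes in [L]; the rest assembles into right multiples of the
   elements [rho b]. *)
pose D c := coord c z - \sum_b a c b * w b.
have -> : \sum_c star c * embed (coord c z) =
    \sum_c star c * embed (D c) + \sum_b rho b * embed (w b).
  rewrite /rho; under [X in _ + X]eq_bigr do rewrite mulr_suml.
  rewrite exchange_big -big_split; apply: eq_bigr => c _.
  rewrite -{1}(subrK (\sum_b a c b * w b) (coord c z)) linearD mulrDr; congr (_ + _).
  rewrite linear_sum mulr_sumr; apply: eq_bigr => b _.
  by rewrite /= mut_embedM mulrA.
refine (ID _ _ _ _); apply: Isum => u.
  apply: (IM _ _ _).1; apply: mut_emb_ideal; apply/qpi_eq.
  rewrite xP linear_sum; apply: eq_bigr => b _.
  by rewrite wP [RHS]rmorphM.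
exact: (IM _ _ (rho_ideal u)).2.
Qed.

(** An endomorphism is determined by its restriction to [tau] and its value at [1 - e_k]. The
    restriction is a scalar with no component in the projective part; the two components of the
    value lift along [beta] and [qpi]. *)
Lemma act_surj (g : End T) : exists z, act z = g.
Proof.
have gD x y : g (x + y) = g x + g y by exact: linearD.
have gZ (l : L) x : g ((l : L^c) *: x) = (l : L^c) *: g x by exact: linearZ_LR.
have in_tauD x y : in_tau (x + y) = in_tau x + in_tau y.
  exact: (linearD (mklin in_tau_linear)).
have in_tauZ (l : L) x : in_tau ((l : L^c) *: x) = (l : L^c) *: in_tau x.
  exact: (linearZ_LR (mklin in_tau_linear)).
have g_tau_proj x : proj_part (g (in_tau x)) = 0.
  apply: (tau_hom0 (h := fun x => proj_part (g (in_tau x)))) => [x1 x2|l x1].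
    by rewrite in_tauD gD proj_partD.
  by rewrite in_tauZ gZ proj_partZ.
have g_tau_lin : linear (fun x => tau_part (g (in_tau x))).
  by move=> l x1 x2; rewrite in_tauD in_tauZ gD gZ tau_partD tau_partZ.
have [c cP] := tau_scalar (mklin g_tau_lin).
have [y yP] := beta_surj (tau_part (g (in_proj 1))).
have [w wP] : exists w : C -> KQ, forall b, Pval (y b) = qpi R (w b).
  by have [w wP] := choice (fun b => qpi_surj (Pval (y b))); exists w.
have [x xP] := qpi_surj (proj_part (g (in_proj 1))).
(* The summand [embed x] already contributes its own coefficient at the trivial path of [k], hence
   the correction of [c]. *)
pose z : KQ' := (c - x@_(triv_path k)) *: e'_k + \sum_b star b * embed (w b) + embed x.
have kap_z : kap z = c.
  rewrite /z !mcoeffD mcoeffZ mut_triv_embed // mcoeff_pelt eqxx mulr1 raddf_sum.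
  by rewrite big1 ?addr0 ?subrK // => b _; exact: mut_triv_star.
have res_z : res z = x * (1 - e_k).
  rewrite /z !linearD linearZ linear_sum /= mut_res_embed //.
  rewrite -(@mut_embed_triv K Q k C j k) mut_res_embed // mulrBr mulr1 triv_idem eqxx subrr scaler0.
  by rewrite big1 ?add0r // => b _; exact: mut_res_star.
have coord_z b : coord b z = pelt K (triv_path (j b)) * w b * (1 - e_k).
  rewrite /z !linearD linearZ linear_sum /= mut_coord_embed //.
  rewrite -(@mut_embed_triv K Q k C j k) mut_coord_embed // scaler0 add0r addr0.
  rewrite (bigD1 b) //= mut_coord_star // eqxx big1 ?addr0 // => b' /negbTE bb.
  by rewrite mut_coord_star // eq_sym bb.
exists z; apply: End_ext => t; change (act_fun z t = g t).
have gt : g t = g (in_tau (tau_part t)) + (proj_part t : L^c) *: g (in_proj 1).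
  by rewrite {1}(T_decomp t) gD -gZ -in_projM mul1r.
rewrite gt; apply: T_ext.
  rewrite tau_part_act [RHS]tau_partD tau_partZ /act_tau kap_z.
  congr (_ + _); first by rewrite -cP.
  rewrite yP -(linearZ_LR beta); congr (beta _).
  apply: functional_extensionality_dep => b; apply: Pval_inj.
  rewrite Pval_pmod_of coord_z -[RHS]Pval_idem.
  change (idem R (j b) * (qpi R (pelt K (triv_path (j b)) * w b * (1 - e_k)) * proj_part t) =
    idem R (j b) * Pval ((proj_part t : L^c) *: y b)).
  rewrite PvalZ wP !rmorphM rmorphB rmorph1 -/(idem R (j b)) -/(idem R k).
  by rewrite -!mulrA proj_part_idem mulrA idemMv.
rewrite proj_part_act [RHS]proj_partD g_tau_proj add0r proj_partZ xP res_z.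
by rewrite rmorphM rmorphB rmorph1 -mulrA proj_part_idem.
Qed.

(** The action is onto with kernel the new ideal, so it descends to the quotient; it is defined
    there on chosen representatives. *)
Theorem mutation_iso : exists f : {linear quotalg R' -> End T},
  monoid_morphism f /\ bijective f.
Proof.
pose f (x : quotalg R') : End T := act (repr (x : quotmod _)).
have fE z : f (qpi R' z) = act z.
  apply/eqP; rewrite -subr_eq0 /f -actB; apply/eqP.
  by apply: act_ideal; apply/qpi_eq; exact: (reprK (qpi R' z : quotmod _)).
have flin : linear f.
  move=> c x y; have [u ->] := qpi_surj x; have [v ->] := qpi_surj y.
  by rewrite -(qpi_linear R' c u v) !fE act_is_linear.
exists (mklin flin); split.
  split=> [|x y]; first by rewrite /= -(rmorph1 (qpi R')) fE act1.
  have [u ->] := qpi_surj x; have [v ->] := qpi_surj y.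
  by rewrite /= -rmorphM !fE actM.
have [h hP] : exists h : End T -> KQ', forall g, act (h g) = g.
  by have [h hP] := choice act_surj; exists h.
exists (fun g => qpi R' (h g)) => [x|g] /=; last by rewrite fE hP.
have [z ->] := qpi_surj x; apply/qpi_eq; apply: act_inj; rewrite fE.
by rewrite actB hP subrr.
Qed.

End EndomorphismAlgebra.

(** * Minimality of the new relations *)

Lemma mcoeff_sum_neq0 (K : fieldType) (Q : quiver) (U : Type) (s : seq U)
    (F : U -> pathalg K Q) q :
  (\sum_(u <- s) F u)@_q != 0 -> exists u, (F u)@_q != 0.
Proof.
rewrite raddf_sum => /eqP nz; apply: contrapT => F0; apply: nz; apply: big1 => u _.
by apply/eqP/negPn/negP => Fu; apply: F0; exists u.
Qed.

Section MinimalRelations.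
Variables (K : fieldType) (Q : quiver) (R : set (pathalg K Q)) (k : vert Q).
Local Notation L := (quotalg R).
Hypotheses (R_minimal : minimal_relations R) (k_sink : is_sink k).
Variables (B C : finType) (i : B -> vert Q) (j : C -> vert Q).
Hypothesis j_neq : forall c, j c != k.
Variables (n : nat) (a : C -> B -> pathalg K Q).
Hypothesis a_paths :
  forall c b p, p \in msupp (a c b) -> pstart p = j c /\ pend p = i b.
Hypotheses (i_neq : (1 < n)%N -> forall b, i b != k)
  (a_triv : forall c b v, (a c b)@_(triv_path v) = 0)
  (a_kernel : (1 < n)%N -> forall x : dsum (fun b => Pmod R (i b)),
    (forall c, \sum_b qpi R (a c b) * Pval (x b) = 0) ->
    forall b v, chi R_minimal.1 v (Pval (x b)) = 0).

Local Notation Q' := (mut_quiver k j).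
Local Notation KQ := (pathalg K Q).
Local Notation KQ' := (pathalg K Q').
Local Notation embed := (@mut_emb K Q k C j).
Local Notation res := (@mut_res K Q k C j).
Local Notation coord := (@mut_coord K Q k C j).
Local Notation star c := (@star Q k C j K c).
Local Notation e_k := (pelt K (triv_path k) : KQ).
Local Notation R' := (mut_relations k j n R a).
Local Notation rho := (rho k j a).

Lemma msupp_mut_emb x q : (embed x)@_q != 0 ->
  exists2 p, p \in msupp x & mut_path k j p = Some q.
Proof.
rewrite {1}(msupp_sum x) linear_sum big_seq => nz.
(* The conditional keeps the membership in the support available after a nonzero summand has been
   extracted. *)
have {nz} [p] : exists p, (if p \in msupp x then embed (x@_p *: pelt K p) else 0)@_q != 0.
  by apply: (@mcoeff_sum_neq0 K Q' _ (msupp x)); rewrite -big_mkcond.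
have [px|_] := boolP (p \in msupp x); last by rewrite mcoeff0 eqxx.
rewrite linearZ /= mcoeffZ mut_embed_pelt; case e : (mut_path k j p) => [q'|] /=.
  have [<- _|/negbTE qq] := eqVneq q' q; first by exists p.
  by rewrite mcoeff_pelt qq -[false%:R]/(0 : K) mulr0 eqxx.
by rewrite mcoeff0 mulr0 eqxx.
Qed.

Lemma mut_path_props p q : mut_path k j p = Some q ->
  [/\ pstart q = pstart p, pend q = pend p & plength q = plength p].
Proof.
have [pS|/mut_pathN ->//] := boolP (all (fun a => tgt a != k) (parrows p)).
have [q' [-> q1 q2 q3]] := mut_pathT j pS => -[<-]; split=> //.
by rewrite /plength q3 size_mut_arrows.
Qed.

Lemma mut_relations_are_relations r : R' r -> is_relation r.
Proof.
have R_relation := R_minimal.1.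
move=> /mut_relationsP[[r0 [Rr0 _ ->]]|[n1 [b ->]]].
  have [v [w rP]] := R_relation _ Rr0; exists v, w => q.
  rewrite -mcoeff_neq0 => /msupp_mut_emb[p /rP[p1 p2 p3]].
  by move=> /mut_path_props[-> -> ->].
exists k, (i b) => q; rewrite -mcoeff_neq0 => /mcoeff_sum_neq0[c].
rewrite (msupp_sum (embed (a c b))) mulr_sumr big_seq => nz.
have {nz} [q'] : exists q', (if q' \in msupp (embed (a c b)) then
    star c * ((embed (a c b))@_q' *: pelt K q') else 0)@_q != 0.
  by apply: (@mcoeff_sum_neq0 K Q' _ (msupp (embed (a c b)))); rewrite -big_mkcond.
have [|_] := boolP (q' \in _); last by rewrite mcoeff0 eqxx.
rewrite -mcoeff_neq0 => /msupp_mut_emb[p pa /mut_path_props[q1 q2 q3]].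
rewrite -pathalg_scaleAr mcoeffZ /Defs.star pelt_mul pmul.unlock.
have [e|ne] := pselect (j c = pstart q'); last first.
  by rewrite pcatN // mcoeff0 mulr0 eqxx.
have [//|u [-> u1 u2 u3]] := @pcat_ex Q' (@arrow_path Q' (inr c)) q'.
rewrite [oapp _ _ _]/= mcoeff_pelt; have [<- _|_] := eqVneq u q; last first.
  by rewrite -[false%:R]/(0 : K) mulr0 eqxx.
have [p1 p2] := a_paths pa.
split; rewrite ?u1 ?u2 ?q2 //.
(* The new arrow has length one, and the entry contributes at least one more arrow because it
   contains no trivial path. *)
rewrite /plength u3 /= ltnS -/(plength q') q3 lt0n.
apply/negP => p0; move: pa; rewrite -mcoeff_neq0.
have -> : p = triv_path (j c).
  by apply: qpath_eq => //; move: p0; rewrite size_eq0 => /eqP.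
by rewrite a_triv eqxx.
Qed.

(** * A generating subset of the new relations is everything *)

Section Subset.
Variable S : set KQ'.
Hypotheses (S_sub : forall r, S r -> R' r) (S_gen : forall r, R' r -> ideal S r).

(** Let [S0] consist of the old relations that end at [k] or have their image in [S]. The morphism
    [res] returns the surviving old relations and kills the new ones, so it maps the ideal of [S]
    into that of [S0]. Hence [S0] generates the old ideal and is all of [R] by minimality. *)
Lemma subset_old r : R r -> ~ ends_at k r -> S (embed r).
Proof.
move=> Rr nk; pose S0 : set KQ := fun x => R x /\ (ends_at k x \/ S (embed x)).
have [I0 ID IM] := ideal_ideal S0.
have res_avoid x : R x -> ~ ends_at k x -> res (embed x) = x.
  move=> Rx nx; rewrite mut_res_embed // mulrBr mulr1.
  have [v [w xP]] := R_minimal.1 _ Rx.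
  have wk : w != k by apply/eqP => wk; apply: nx => p /xP[_ -> _].
  have xw : x * pelt K (triv_path w) = x by apply: mul_triv_end => p /xP[].
  by rewrite -{2}xw -mulrA triv_idem (negbTE wk) mulr0 subr0.
have res_S z : ideal S z -> ideal S0 (res z).
  apply: (@ideal_sub K Q' S (fun z => ideal S0 (res z))).
    split=> [|x y Ix Iy|x y Iy]; first by rewrite linear0.
      by rewrite mut_resD; exact: ID.
    by rewrite !mut_resM //; exact: IM.
  move=> s Ss; have /mut_relationsP[[r0 [Rr0 nr0 se]]|[_ [b ->]]] := S_sub Ss.
    by rewrite se res_avoid //; apply: ideal_gen; split=> //; right; rewrite -se.
  by rewrite linear_sum big1 // => c _; exact: mut_res_star.
suff S0R : S0 = R.
  by have [_ [/nk|]] : S0 r by rewrite S0R.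
apply: (R_minimal.2 S0); first by move=> x [].
apply/seteqP; split=> x.
  apply: ideal_sub; first exact: ideal_ideal.
  by move=> y [Ry _]; exact: ideal_gen.
apply: ideal_sub; first exact: ideal_ideal.
move=> y Ry; have [yk|yk] := pselect (ends_at k y); first by apply: ideal_gen; split=> //; left.
rewrite -(res_avoid y) //; apply: res_S; apply: S_gen.
by apply/mut_relationsP; left; exists y.
Qed.

(** If [rho b] were missing from [S], column [b] of the matrix would be a combination of the other
    columns over [L]. The resulting kernel element has the idempotent [e_(i b)] as its coordinate at
    [b], which contradicts [a_kernel]. *)
Lemma subset_new b : (1 < n)%N -> S (rho b).
Proof.
move=> n1; apply: contrapT => nS.
have [I0 ID IM] := ideal_ideal R.
(* Elements whose coordinates need no contribution from column [b]: left multiplication rescales the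
   coefficients [l], right multiplication multiplies them by [res], so the condition [l b = 0]
   persists. *)
pose J : set KQ' := fun z => [/\ qpi R (res z) = 0, z@_(@triv_path Q' k) = 0 &
  exists l : B -> L, l b = 0 /\
    forall c, qpi R (coord c z) = \sum_b' qpi R (a c b') * (idem R (i b') * l b')].
have J_ideal : two_sided_ideal J.
  split.
  - split; [by rewrite linear0 qpi0|exact: mcoeff0|exists (fun _ => 0); split=> // c].
    by rewrite linear0 qpi0 big1 // => b' _; rewrite !mulr0.
  - move=> x y [x1 x2 [l [lb lP]]] [y1 y2 [l' [lb' lP']]].
    split; [|by rewrite mcoeffD x2 y2 addr0|exists (fun b => l b + l' b)].
      by rewrite mut_resD qpiD x1 y1 addr0.
    split=> [|c]; first by rewrite lb lb' addr0.
    rewrite mut_coordD qpiD lP lP' -big_split.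
    by apply: eq_bigr => b' _; rewrite !mulrDr.
  - move=> x y [y1 y2 [l [lb lP]]]; split; split.
    + by rewrite mut_resM // qpiM y1 mulr0.
    + by rewrite triv_coefM y2 mulr0.
    + exists (fun b => x@_(@triv_path Q' k) *: l b); rewrite lb scaler0; split=> // c.
      rewrite mut_coordM // (qpi_linear R) qpiM y1 mulr0 addr0 lP scaler_sumr.
      by apply: eq_bigr => b' _; rewrite !quotalg_scaleAr.
    + by rewrite mut_resM // qpiM y1 mul0r.
    + by rewrite triv_coefM y2 mul0r.
    + exists (fun b => l b * qpi R (res x)); rewrite lb mul0r; split=> // c.
      rewrite mut_coordM // y2 scale0r add0r qpiM lP mulr_suml.
      by apply: eq_bigr => b' _; rewrite !mulrA.
have SJ s : S s -> J s.
  move=> Ss; have Rs := S_sub Ss; split; [|exact: (kap_relation R_minimal.1 k_sink Rs)|].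
    by apply/qpi_eq0; exact: (res_relation k_sink Rs).
  have [l [lN lP]] := coord_relation k_sink j_neq a_paths i_neq Rs.
  by exists l; split=> //; apply: lN => e; apply: nS; rewrite e.
have rhoR : R' (rho b) by apply/mut_relationsP; right; split=> //; exists b.
have [_ _ [l [lb lP]]] := ideal_sub J_ideal SJ (S_gen rhoR).
(* The syzygy: the unit vector at [b] minus the coefficients that express column [b]. *)
pose x : dsum (fun b => Pmod R (i b)) := fun b' =>
  pmod_of (i b') ((b' == b)%:R - l b').
have x0 c : \sum_b' qpi R (a c b') * Pval (x b') = 0.
  have rc : qpi R (coord c (rho b)) = qpi R (a c b).
    rewrite linear_sum (bigD1 c) //= big1 ?addr0; last first.
      by move=> c' /negbTE cc; rewrite mut_coord_star // eq_sym cc.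
    rewrite mut_coord_star // eqxx (a_start a_paths) mulrBr mulr1.
    by rewrite -{2}(a_end a_paths c b) -mulrA triv_idem (negbTE (i_neq n1 b)) mulr0 subr0.
  have -> : \sum_b' qpi R (a c b') * Pval (x b') =
      \sum_b' (if b' == b then qpi R (a c b') * idem R (i b') else 0) -
      \sum_b' qpi R (a c b') * (idem R (i b') * l b').
    rewrite -sumrB; apply: eq_bigr => b' _; rewrite Pval_pmod_of mulrBr mulrBr.
    by case: eqP => _; rewrite ?mulr1 ?mulr0.
  rewrite -lP rc -big_mkcond big_pred1_eq /idem -qpiM (a_end a_paths).
  exact: subrr.
have /eqP := a_kernel n1 x0 b (i b).
by rewrite Pval_pmod_of eqxx lb subr0 mulr1 chi_idem eqxx oner_eq0.
Qed.
End Subset.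

Lemma mut_relations_minimal : minimal_relations R'.
Proof.
split=> [r|S SR' S_ideal]; first exact: mut_relations_are_relations.
have S_gen r : R' r -> ideal S r by move=> Rr; rewrite S_ideal; exact: ideal_gen.
apply/seteqP; split=> // r /mut_relationsP[[r0 [Rr0 nr0 ->]]|[n1 [b ->]]].
  exact: (subset_old SR' S_gen).
exact: (subset_new SR' S_gen).
Qed.

End MinimalRelations.

(** * Presentation of tau_n^- P_k *)

(** At a sink, [P_k] is spanned by [e_k] over [K]. *)
Lemma Pmod_sink_scalar (K : fieldType) (Q : quiver) (R : set (pathalg K Q)) k
    (R_relation : forall r, R r -> is_relation r) (k_sink : is_sink k)
    (g : {linear Pmod R k -> Pmod R k}) :
  exists c : K, forall x, g x = scal R c *: x.
Proof.
pose e := pmod_of k (1 : quotalg R).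
have eP x : exists c : K, x = scal R c *: e.
  have [y yP] := PvalE x; exists (chi R_relation k y).
  apply: Pval_inj; rewrite PvalZ Pval_pmod_of mulr1 yP idem_sink //.
  by rewrite /scal -quotalg_scaleAr mulr1.
have [c cP] := eP (g e); exists c => x; have [d ->] := eP x.
by rewrite linearZ_LR cP !scalerA scal_central.
Qed.

Section Presentation.
Variables (K : fieldType) (Q : quiver) (R : set (pathalg K Q)) (k : vert Q).
Local Notation L := (quotalg R).
Hypotheses (R_relation : forall r, R r -> is_relation r) (k_sink : is_sink k)
  (L_findim : fingen (L : lmodType K)).
Variables (I : injres (Pmod R k)).
Hypothesis I_minimal : minimal_injres I.
Local Notation chi := (chi R_relation).

Lemma chi_eigen_pos p (y : I p) : (0 < p)%N -> chi_eigen R_relation k y -> y = 0.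
Proof. by case: p y => // p y _; exact: chi_eigen_sink. Qed.

(** In degree 0 a socle element is a cocycle, hence comes from [P_k], on which [e_v] acts as
    zero. *)
Lemma chi_eigen_base p v (y : I p) : ~~ (0 < p)%N -> v != k ->
  chi_eigen R_relation v y -> y = 0.
Proof.
case: p y => // y _ vk ey; have [x yx] := irexact0 (chi_eigen_cdiff I_minimal ey).
rewrite -(chi_eigen_idem ey) yx -linearZ_LR.
have -> : (idem R v : L^c) *: x = 0; last exact: linear0.
apply: Pval_inj; rewrite PvalZ Pval0; have [u ->] := PvalE x.
by rewrite (idem_sink R_relation) // -quotalg_scaleAl idemMw ?scaler0 // eq_sym.
Qed.

(** * The vertices occurring in the projective terms *)

Section Terms.
Variables (p : nat) (B : finType) (i : B -> vert Q).
Variable phi : {linear dsum (fun b => Pmod R (i b)) -> nuinv (I p)}.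
Hypothesis phi_bij : bijective phi.

Lemma nuinv_chi_eigen (u : nuinv (I p)) v : chi_eigen R_relation v (u (chi v)).
Proof. exact: (chi_eigen_map u (@chi_eigen_dual _ _ _ R_relation v)). Qed.

(** A summand [P_k] would produce a nonzero socle element of type [S_k] in positive degree. *)
Lemma vertex_neq_sink b : (0 < p)%N -> i b != k.
Proof.
move=> p0; apply/eqP => ik.
have [z [_ [_]]] := coord_vertex R_relation L_findim (irfg I p) (@irinj _ _ I p) phi_bij b.
by rewrite ik; apply; apply: chi_eigen_pos => //; exact: nuinv_chi_eigen.
Qed.

Lemma vertex_eq_sink b : ~~ (0 < p)%N -> i b = k.
Proof.
move=> p0; apply/eqP/negPn/negP => ik.
have [z [_ [_]]] := coord_vertex R_relation L_findim (irfg I p) (@irinj _ _ I p) phi_bij b.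
by apply; apply: (chi_eigen_base p0 ik); exact: nuinv_chi_eigen.
Qed.

(** The cycle [u] is the image of some [w] because [Ext] vanishes, and the differential kills the
    socle element [w (chi v)]. *)
Lemma nuinv_cycle_chi (u : nuinv (I p)) v : (0 < p)%N -> trivial_mod (ExtD I p) ->
  nuinv_map (cdiff I p) u = 0 -> u (chi v) = 0.
Proof.
case: p u => // q u _ triv /(ExtD_exact triv)[w <-].
exact: (chi_eigen_cdiff I_minimal (chi_eigen_map w (@chi_eigen_dual _ _ _ R_relation v))).
Qed.

End Terms.

(** * The matrix of the last differential *)

Section Matrix.
Variables (m : nat) (B C : finType) (i : B -> vert Q) (j : C -> vert Q).
Variables (phi : {linear dsum (fun b => Pmod R (i b)) -> nuinv (I m)})
  (psi : {linear nuinv (I m.+1) -> dsum (fun c => Pmod R (j c))}).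
Hypotheses (phi_bij : bijective phi) (psi_bij : bijective psi).
Variable a : C -> B -> pathalg K Q.
Hypotheses
  (a_paths : forall c b p, p \in msupp (a c b) -> pstart p = j c /\ pend p = i b)
  (a_matrix : forall x c, Pval (psi (nuinv_map (cdiff I m) (phi x)) c) =
      \sum_b qpi R (a c b) * Pval (x b)).

Lemma target_neq_sink c : j c != k.
Proof.
have [psi' [psiK psi'K]] := bijective_linear_inv psi_bij.
by apply: (@vertex_neq_sink m.+1 C j psi'); first by exists psi.
Qed.

(** The differential kills socle elements, so the image of the unit vector [b] vanishes at [chi v].
    Its coordinates are the entries of column [b], on which [chi v] is the coefficient at the
    trivial path. *)
Lemma matrix_triv_coef c b v : (a c b)@_(triv_path v) = 0.
Proof.
have [psi' [psiK psi'K]] := bijective_linear_inv psi_bij.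
have psi'_bij : bijective psi' by exists psi.
have [z [zb [zN _]]] :=
  coord_vertex R_relation L_findim (irfg I m) (@irinj _ _ I m) phi_bij b.
have w0 : nuinv_map (cdiff I m) (phi z) (chi v) = 0.
  exact: (chi_eigen_cdiff I_minimal (nuinv_chi_eigen (phi z) v)).
have := @coord_chi _ _ _ R_relation L_findim _ _ _ psi' (irfg I m.+1) (@irinj _ _ I m.+1)
  psi'_bij (psi (nuinv_map (cdiff I m) (phi z))) c v.
rewrite psiK a_matrix => /(_ w0).
rewrite (bigD1 b) //= big1 ?addr0 => [|b' bb]; last by rewrite zN ?mulr0.
by rewrite zb /idem -qpiM (a_end a_paths) (chi_funE R_relation).
Qed.

(** A kernel element of the matrix is a cycle in [nu^- I^m], so it vanishes at every [chi v], and
    then [chi v] vanishes on its coordinates. *)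
Lemma matrix_kernel_chi (x : dsum (fun b => Pmod R (i b))) :
  (0 < m)%N -> trivial_mod (ExtD I m) ->
  (forall c, \sum_b qpi R (a c b) * Pval (x b) = 0) ->
  forall b v, chi v (Pval (x b)) = 0.
Proof.
move=> m0 triv ax b v; apply: (coord_chi L_findim (irfg I m) (@irinj _ _ I m) phi_bij).
apply: nuinv_cycle_chi => //; apply: (bij_inj psi_bij); rewrite linear0.
apply: functional_extensionality_dep => c; apply: Pval_inj.
by rewrite a_matrix ax; exact: esym (Pval0 _ _).
Qed.

Lemma ExtD_presentation : injres_length_le I m.+1 ->
  exists beta : {linear dsum (fun c => Pmod R (j c)) -> ExtD I m.+1},
    (forall x, exists y, x = beta y) /\
    (forall y, beta y = 0 <-> exists x : dsum (fun b => Pmod R (i b)),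
      forall c, Pval (y c) = \sum_b qpi R (a c b) * Pval (x b)).
Proof.
move=> I_length; have [beta [bsurj bker]] := ExtD_last I_length.
have [psi' [psiK psi'K]] := bijective_linear_inv psi_bij.
have [phi' [phiK phi'K]] := bijective_linear_inv phi_bij.
exists (beta \o psi'); split=> [x|y].
  by have [u ->] := bsurj x; exists (psi u); rewrite /= psiK.
split=> [/bker[w wy]|[x xy]].
  by exists (phi' w) => c; rewrite -a_matrix phi'K wy psi'K.
apply/bker; exists (phi x); apply: (bij_inj psi_bij); rewrite psi'K.
by apply: functional_extensionality_dep => c; apply: Pval_inj; rewrite a_matrix xy.
Qed.

End Matrix.
End Presentation.

(* n is m.+1, I is the minimal injective resolution of P_k *)
Theorem proposition6p3 (K : closedFieldType) (Q : quiver)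
    (Q_connected : connected_quiver Q) (Q_acyclic : acyclic_quiver Q)
    (R : set (pathalg K Q)) (R_minimal : minimal_relations R)
    (L_findim : fingen (quotalg R : lmodType K))
    (k : vert Q) (k_sink : is_sink k)
    (m : nat) (k_admits : admits_nAPR R m.+1 k)
    (I : injres (Pmod R k)) (I_minimal : minimal_injres I)
    (I_length : injres_length_le I m.+1)
    (B C : finType) (i : B -> vert Q) (j : C -> vert Q)
    (phi : {linear dsum (fun b => Pmod R (i b)) -> nuinv (I m)})
    (phi_bij : bijective phi)
    (psi : {linear nuinv (I m.+1) -> dsum (fun c => Pmod R (j c))})
    (psi_bij : bijective psi)
    (a : C -> B -> pathalg K Q)
    (a_paths : forall c b p, p \in msupp (a c b) -> pstart p = j c /\ pend p = i b)
    (a_matrix : forall x c,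
      Pval (psi (nuinv_map (cdiff I m) (phi x)) c) =
      \sum_b qpi R (a c b) * Pval (x b)) :
  let R' : set (pathalg K (mut_quiver k j)) := mut_relations k j m.+1 R a in
  (exists f : {linear quotalg R' -> End (nAPR_module m.+1 I)},
     monoid_morphism f /\ bijective f) /\
  minimal_relations R'.
Proof.
have R_rel := R_minimal.1; have [[_ I_dim] I_triv] := k_admits.
have j_neq := target_neq_sink R_rel k_sink L_findim I_minimal psi_bij.
have i_neq : (1 < m.+1)%N -> forall b, i b != k.
  by move=> m1 b; exact: (vertex_neq_sink R_rel k_sink L_findim I_minimal phi_bij).
have i_eq : ~~ (1 < m.+1)%N -> forall b, i b = k.
  by move=> m1 b; exact: (vertex_eq_sink R_rel k_sink L_findim I_minimal phi_bij).
have [beta [beta_surj beta_ker]] := ExtD_presentation phi_bij psi_bij a_matrix I_length.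
split.
  apply: (mutation_iso R_rel k_sink j_neq a_paths i_neq i_eq beta_surj beta_ker).
  - by move=> h; exact: ExtD_to_alg0.
  - apply: (ExtD_scalar L_findim _ _ I_length); first by move=> p pm; exact: I_triv.
    exact: Pmod_sink_scalar.
  - exact: (ExtD_nontrivial L_findim I_minimal I_length I_dim).
apply: (mut_relations_minimal k_sink j_neq a_paths i_neq).
  exact: (matrix_triv_coef R_rel L_findim I_minimal phi_bij psi_bij a_paths a_matrix).
(* For [n > 1] the degree [m] is positive and still below [n], so [Ext^m] vanishes. *)
move=> m1 x x0; apply: (matrix_kernel_chi _ L_findim I_minimal phi_bij psi_bij a_matrix) => //.
exact: I_triv.
Qed.
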